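(* Let $T>0$, $s\in(0,1)$ and $\tau=sT$. Suppose the null hypothesis holds, i.e. $(X_t)_{0\le t\le T}$ solves $dX_t=\big(\sum_{i=1}^p\mu_i\varphi_i(t)-\alpha X_t\big)dt+\sigma\,dB_t$ on $[0,T]$ for one fixed parameter vector $(\mu_1,\ldots,\mu_p,\alpha)^t\in\Theta=\mathbb{R}^p\times(0,\infty)$, suppose that $\mathbb{P}\big(\int_0^{T'}S(\theta,t,X_t)^2dt<\infty\big)=1$ for all $0\le T'<\infty$ and all $\theta$, and suppose that the matrices $Q_T$, $Q_\tau$ and $Q_T-Q_\tau$ are invertible. Then the log-transformed generalized likelihood ratio test statistic $\Lambda_T(s)=-2\ln\mathcal{R}(X^T)$ of the test problem $H_0:\theta=\theta'$ (no change) against $H_A:\theta\ne\theta'$ (change at time point $\tau$) can be represented under the null hypothesis as $$\Lambda_T(s)=-R_T^tQ_T^{-1}R_T+R_\tau^tQ_\tau^{-1}R_\tau+(R_T-R_\tau)^t(Q_T-Q_\tau)^{-1}(R_T-R_\tau),$$ where $$R_T=\Big(\int_0^T\varphi_1(t)\,dB_t,\ldots,\int_0^T\varphi_p(t)\,dB_t,-\int_0^TX_t\,dB_t\Big)^t .$$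
   Context: $(B_t)_{t\ge0}$ is a standard Brownian motion, $X_0$ a square-integrable real random variable independent of it, $\sigma>0$ a known constant, $\varphi_1,\ldots,\varphi_p$ known non-random functions. The parameter space is $\Theta=\mathbb{R}^p\times(0,\infty)$. For $\theta=(\mu_1,\ldots,\mu_p,\alpha)^t$ put $S(\theta,t,x)=\sum_{i=1}^p\mu_i\varphi_i(t)-\alpha x$. The superscript $t$ on vectors and matrices denotes transposition. For any $T$ (and likewise with $\tau$ in place of $T$), $$Q_T=\begin{pmatrix}G_T&-a_T\\-a_T^t&b_T\end{pmatrix}\in\mathbb{R}^{(p+1)\times(p+1)},$$ with $G_T=\big(\int_0^T\varphi_j(t)\varphi_k(t)dt\big)_{1\le j,k\le p}$, $a_T=\big(\int_0^T\varphi_1(t)X_tdt,\ldots,\int_0^T\varphi_p(t)X_tdt\big)^t$, $b_T=\int_0^TX_t^2dt$; $R_\tau$ is defined as $R_T$ with $T$ replaced by $\tau$. The likelihood function of the model $dX_t=(S(\theta,t,X_t)\mathbf{1}_{\{t\le\tau\}}+S(\theta',t,X_t)\mathbf{1}_{\{t>\tau\}})dt+\sigma dB_t$, $0\le t\le T$, is given by $$\ln\mathcal{L}(\theta,\theta',X^T)=\frac1{\sigma^2}\Big(\int_0^{\tau}S(\theta,t,X_t)\,dX_t+\int_\tau^TS(\theta',t,X_t)\,dX_t\Big)-\frac1{2\sigma^2}\Big(\int_0^\tau S(\theta,t,X_t)^2dt+\int_\tau^TS(\theta',t,X_t)^2dt\Big),$$ where $X^T=\{X_t,0\le t\le T\}$,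 and the generalized likelihood ratio is $$\mathcal{R}(X^T)=\frac{\sup_{\theta\in\Theta}\mathcal{L}(\theta,\theta,X^T)}{\sup_{\theta,\theta'\in\Theta}\mathcal{L}(\theta,\theta',X^T)}.$$
   Formalization: The identity is asserted almost surely on the event that both suprema over Θ in the generalized likelihood ratio are attained (the ML estimators exist in Θ); when an unconstrained maximizer has α<0, which has positive probability, the displayed formula can fail. *)

(* Defs.v *)
From HB Require Import structures.
From mathcomp Require Import all_boot all_order all_algebra.
From mathcomp Require Import all_classical all_reals all_analysis.
Import Order.TTheory GRing.Theory Num.Theory.
Import numFieldNormedType.Exports.

Set Implicit Arguments.
Unset Strict Implicit.
Unset Printing Implicit Defensive.

Local Open Scope classical_set_scope.
Local Open Scope ring_scope.

Section StochasticProcesses.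
Context (R : realType) (d : measure_display) (Omega : measurableType d).
Context (P : probability Omega R).

Implicit Types (Z B X : R -> Omega -> R) (a b t : R).

(* The sigma-algebra generated by the variables Z u, u in D. *)
Definition sigma_of (D : set R) Z : set (set Omega) :=
  <<s \bigcup_(u in D) preimage_set_system setT (Z u) measurable >>.

Definition measurable_wrt (G : set (set Omega)) (h : Omega -> R) : Prop :=
  forall Y : set R, measurable Y -> G (h @^-1` Y).

Definition independent_sigma (G1 G2 : set (set Omega)) : Prop :=
  forall A1 A2, G1 A1 -> G2 A2 -> P (A1 `&` A2) = (P A1 * P A2)%E.

Definition standard_brownian_motion B : Prop :=
  [/\ forall t, 0 <= t -> measurable_fun setT (B t),
      {ae P, forall w, B 0 w = 0},
      {ae P, forall w, {within `[0, +oo[, continuous (fun t => B t w)}},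
      forall r t, 0 <= r -> r < t -> forall Y : set R, measurable Y ->
        P ((fun w => B t w - B r w) @^-1` Y) =
        normal_prob 0 (Num.sqrt (t - r)) Y &
      forall r t, 0 <= r -> r < t ->
        independent_sigma (sigma_of `[0, r] B)
          (preimage_set_system setT (fun w => B t w - B r w) measurable)].

(* The filtration generated by the initial value X0 and by B. *)
Definition filtration (X0 : Omega -> R) B t : set (set Omega) :=
  <<s preimage_set_system setT X0 measurable `|` sigma_of `[0, t] B >>.

(* Convergence to 0 in probability. The values of P are meaningful on
   measurable sets only, so the exceptional set is covered by a measurable one;
   for measurable Z_ n this is the usual P(|Z_ n| >= e) --> 0. *)
Definition cvg0_in_probability (Z_ : nat -> Omega -> \bar R) : Prop :=
  forall e del : R, 0 < e -> 0 < del ->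
  \forall n \near \oo, exists A : set Omega,
    [/\ measurable A, (P A <= del%:E)%E &
        forall w, ~ A w -> (`|Z_ n w| < e%:E)%E].

(* H = \sum_(i < n) h_i 1_(t_i, t_i+1], with
   n = sp_size, t_i = sp_time i, h_i = sp_coef i. *)
Record simple_process := SimpleProcess {
  sp_size : nat;
  sp_time : nat -> R;
  sp_coef : nat -> Omega -> R }.

Definition simple_process_on (F : R -> set (set Omega)) a b
    (H : simple_process) : Prop :=
  [/\ sp_time H 0 = a,
      sp_time H (sp_size H) = b,
      forall i, (i < sp_size H)%N -> sp_time H i <= sp_time H i.+1,
      forall i, (i < sp_size H)%N ->
        measurable_wrt (F (sp_time H i)) (sp_coef H i) &
      forall i, (i < sp_size H)%N ->
        exists C : R, forall w, `|sp_coef H i w| <= C].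

Definition sp_value (H : simple_process) t (w : Omega) : R :=
  \sum_(i < sp_size H)
    sp_coef H i w * \1_(`]sp_time H i, sp_time H i.+1]) t.

Definition sp_integral B (H : simple_process) (w : Omega) : R :=
  \sum_(i < sp_size H)
    sp_coef H i w * (B (sp_time H i.+1) w - B (sp_time H i) w).

(* I is (a version of) the Ito integral of H against B over [a, b]: the limit
   in probability of the integrals of simple processes H_ n with
   \int_a^b (H_ n - H)^2 dt --> 0 in probability. *)
Definition is_ito_integral (F : R -> set (set Omega)) B a b
    (H : R -> Omega -> R) (I : Omega -> R) : Prop :=
  measurable_fun setT I /\
  exists H_ : nat -> simple_process,
    [/\ forall n, simple_process_on F a b (H_ n),
        cvg0_in_probability (fun n w =>
          (\int[lebesgue_measure]_(t in `[a, b])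
             ((sp_value (H_ n) t w - H t w) ^+ 2)%:E)%E) &
        cvg0_in_probability (fun n w => (sp_integral B (H_ n) w - I w)%:E)].

(* J is (a version of) \int_a^b H dX for an Ito process
   dX = drift dt + sigma dB. *)
Definition is_ito_process_integral (F : R -> set (set Omega)) B
    (drift : R -> Omega -> R) (sigma : R) a b
    (H : R -> Omega -> R) (J : Omega -> R) : Prop :=
  exists2 I : Omega -> R, is_ito_integral F B a b H I &
  {ae P, forall w, J w =
     \int[lebesgue_measure]_(t in `[a, b]) (H t w * drift t w) + sigma * I w}.

End StochasticProcesses.

Section Model.
Context (R : realType) (d : measure_display) (Omega : measurableType d).
Context (P : probability Omega R) (p : nat).

(* theta = (mu_1, ..., mu_p, alpha)^t *)
Definition mu_of (theta : 'cV[R]_(p + 1)) (i : 'I_p) : R :=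
  theta (lshift 1 i) ord0.
Definition alpha_of (theta : 'cV[R]_(p + 1)) : R :=
  theta (rshift p ord0) ord0.

Definition Theta : set 'cV[R]_(p + 1) := [set theta | 0 < alpha_of theta].

Context (phi : 'I_p -> R -> R).

Definition Sfun (theta : 'cV[R]_(p + 1)) (t x : R) : R :=
  \sum_(i < p) mu_of theta i * phi i t - alpha_of theta * x.

Context (sigma : R) (B X : R -> Omega -> R).

(* X solves dX = Sfun(theta, t, X) dt + sigma dB on [0, T]. Adaptedness of X is
   not imposed: as the noise is additive and the drift affine in x, the
   integral equation determines X, almost surely, from X 0 and B. *)
Definition is_solution (theta : 'cV[R]_(p + 1)) (T : R) : Prop :=
  [/\ forall t, 0 <= t -> measurable_fun setT (X t),
      {ae P, forall w, {within `[0, T], continuous (fun t => X t w)}} &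
      {ae P, forall w, forall t, 0 <= t <= T ->
        X t w = X 0 w
          + \int[lebesgue_measure]_(u in `[0, t]) Sfun theta u (X u w)
          + sigma * B t w}].

Definition G_mx (T : R) : 'M[R]_p :=
  \matrix_(j, k) \int[lebesgue_measure]_(t in `[0, T]) (phi j t * phi k t).

Definition a_vec (T : R) (w : Omega) : 'cV[R]_p :=
  \col_j \int[lebesgue_measure]_(t in `[0, T]) (phi j t * X t w).

Definition b_val (T : R) (w : Omega) : R :=
  \int[lebesgue_measure]_(t in `[0, T]) (X t w ^+ 2).

Definition Q_mx (T : R) (w : Omega) : 'M[R]_(p + 1) :=
  block_mx (G_mx T) (- a_vec T w) (- (a_vec T w)^T) (b_val T w)%:M.

(* RT = (\int_0^T phi_1 dB, ..., \int_0^T phi_p dB, - \int_0^T X dB)^t *)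
Definition is_R_vector (T : R) (RT : Omega -> 'cV[R]_(p + 1)) : Prop :=
  let ito := is_ito_integral P (filtration (X 0) B) B 0 T in
  (forall i, ito (fun t _ => phi i t) (fun w => RT w (lshift 1 i) ord0)) /\
  exists2 I, ito X I & forall w, RT w (rshift p ord0) ord0 = - I w.

(* lnL theta theta' is ln L(theta, theta', X^T), for X solving the equation
   with parameter theta0. Its Ito integrals are defined up to a null set
   depending on (theta, theta'), whereas the suprema below need all parameters
   for one and the same w: as usual, lnL is a version that is almost surely
   continuous in (theta, theta'). *)
Definition is_log_likelihood (theta0 : 'cV[R]_(p + 1)) (tau T : R)
    (lnL : 'cV[R]_(p + 1) -> 'cV[R]_(p + 1) -> Omega -> R) : Prop :=
  let int_dX := is_ito_process_integral P (filtration (X 0) B) B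
                  (fun t w => Sfun theta0 t (X t w)) sigma in
  (forall theta theta', Theta theta -> Theta theta' ->
    exists J1 J2 : Omega -> R,
      [/\ int_dX 0 tau (fun t w => Sfun theta t (X t w)) J1,
          int_dX tau T (fun t w => Sfun theta' t (X t w)) J2 &
          {ae P, forall w, lnL theta theta' w =
            (sigma ^+ 2)^-1 * (J1 w + J2 w)
            - (2 * sigma ^+ 2)^-1 *
              (\int[lebesgue_measure]_(t in `[0, tau])
                  (Sfun theta t (X t w) ^+ 2)
               + \int[lebesgue_measure]_(t in `[tau, T])
                  (Sfun theta' t (X t w) ^+ 2))}]) /\
  {ae P, forall w, {within Theta `*` Theta,
    continuous (fun th : 'cV[R]_(p + 1) * 'cV[R]_(p + 1) =>
                  lnL th.1 th.2 w)}}.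

Context (lnL : 'cV[R]_(p + 1) -> 'cV[R]_(p + 1) -> Omega -> R).

Definition glr (w : Omega) : R :=
  sup [set expR (lnL theta theta w) | theta in Theta] /
  sup [set expR (lnL th.1 th.2 w) | th in Theta `*` Theta].

Definition Lambda (w : Omega) : R := - 2 * ln (glr w).

(* The maximum likelihood estimators under H_0 and under the full model exist
   in the parameter space: both suprema in glr are attained. Theta being open,
   this fails when an unconstrained maximizer of the likelihood has alpha <= 0,
   which happens with positive probability. *)
Definition mle_exist (w : Omega) : Prop :=
  (exists2 th, Theta th &
     forall theta, Theta theta -> lnL theta theta w <= lnL th th w) /\
  (exists th th', [/\ Theta th, Theta th' &
     forall theta theta', Theta theta -> Theta theta' ->
       lnL theta theta' w <= lnL th th' w]).

End Model.

(* Main.v *)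
Require Import Defs.
From HB Require Import structures.
From mathcomp Require Import all_boot all_order all_algebra.
From mathcomp Require Import all_classical all_reals all_analysis.
From mathcomp Require Import measurable_realfun.
From mathcomp Require Import ring lra.
Import Order.TTheory GRing.Theory Num.Theory.
Import numFieldNormedType.Exports.

(** Write psi = (phi_1, ..., phi_p, - X) for the vector of regressors. Then
    S(theta, t, X_t) is the dot product of theta and psi(t), the matrix Q_t is
    the Gram matrix of psi on [0, t], and R_t is the vector of the Ito
    integrals of psi over [0, t]. Substituting dX = S(theta0) dt + sigma dB in
    the log-likelihood turns it into (2 sigma^2)^-1 times the sum of
      2 c1 . theta  - theta  . Q_tau theta           and
      2 c2 . theta' - theta' . (Q_T - Q_tau) theta',
    where c1 = Q_tau theta0 + sigma R_tau and
    c2 = (Q_T - Q_tau) theta0 + sigma (R_T - R_tau); on the diagonal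
    theta = theta' the two parts add up to the same expression with
    c = Q_T theta0 + sigma R_T and Q_T. The parameter space is open, so that a
    maximizer in it is a critical point, and the maximum of
    2 c . u - u . Q u is c . Q^-1 c, that is
      theta0 . Q theta0 + 2 sigma theta0 . R + sigma^2 R . Q^-1 R.
    The first two terms are additive in (Q, R): they cancel between numerator
    and denominator of the likelihood ratio, and the third terms remain
    (Lambda_quadratic).

    The rest justifies the substitution, almost surely and for all parameters
    at once. The Ito integral of S(theta) in the likelihood is one version
    among many, and the one over [tau, T] is not given as a difference. So it
    must be shown that Ito integrals are linear (ito_integral_comb), additive
    over adjacent intervals (ito_integral_cat) and unique up to a null set
    (ito_integral_unique). Linearity follows from a common refinement of the
    partitions of two simple processes. Uniqueness says that the integrals of
    simple processes tend to 0 in probability when their energies do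
    (sp_integral_cvg0). For this, a simple process is truncated where its
    energy exceeds a level c, which keeps it adapted; the square of its
    integral then has expectation at most 8 c, since a Brownian increment over
    ]r, t] is independent of the past and a centred Gaussian
    (increment_sqr_le).

    The formula for the log-likelihood thus holds outside a null set that
    depends on (theta, theta'). Countably many rational parameters share one
    null set, and continuity in the parameters extends the formula to all of
    them (dense_Theta_eq). *)

Set Implicit Arguments.
Unset Strict Implicit.
Unset Printing Implicit Defensive.

Local Open Scope classical_set_scope.
Local Open Scope ring_scope.

(** * Second moments of affine functions of a Gaussian variable *)

Section Gaussian.
Context (R : realType).
Implicit Types (s m h : R).
Local Notation mu := lebesgue_measure.
Local Open Scope ereal_scope.

(** The Radon-Nikodym derivative of the normal law is its density almost
    everywhere, because both have the same integrals over measurable sets. *)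
Lemma ge0_integral_normal_prob m s (f : R -> \bar R) :
  measurable_fun setT f -> (forall x, 0 <= f x) ->
  \int[normal_prob m s]_x f x = \int[mu]_x (f x * (normal_pdf m s x)%:E).
Proof.
move=> mf f0.
have dom := @normal_prob_dominates R m s.
have mpdf : measurable_fun setT (fun x : R => (normal_pdf m s x)%:E).
  by apply/measurable_EFinP; exact: measurable_normal_pdf.
rewrite -(Radon_Nikodym_SigmaFinite.change_of_variables dom f0 measurableT mf).
have iRN := Radon_Nikodym_SigmaFinite.f_integrable dom.
apply: ae_eq_integral => //.
- by apply: emeasurable_funM => //; exact: measurable_int iRN.
- exact: emeasurable_funM.
- apply: ae_eqe_mul2l.
  apply: integral_ae_eq => // A _ mA.
  by rewrite -Radon_Nikodym_SigmaFinite.f_integral.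
Qed.

Lemma normal_pdfN s (x : R) : s != 0%R ->
  normal_pdf 0 s (- x) = normal_pdf 0 s x.
Proof. by move=> s0; rewrite normal_pdfE// /normal_fun !subr0 sqrrN. Qed.

(** Symmetry stands in for the vanishing mean, so that only integrals of
    nonnegative functions occur below. *)
Lemma ge0_integral_normal_probN s (f : R -> \bar R) : s != 0%R ->
  measurable_fun setT f -> (forall x, 0 <= f x) ->
  \int[normal_prob 0 s]_x f (- x)%R = \int[normal_prob 0 s]_x f x.
Proof.
move=> s0 mf f0.
have mN : measurable_fun setT (-%R : R -> measurableTypeR R).
  exact: oppr_measurable.
rewrite !ge0_integral_normal_prob//; last by apply: measurableT_comp.
pose g := fun x : R => f x * (normal_pdf 0 s x)%:E.
have mg : measurable_fun setT g.
  apply: emeasurable_funM => //.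
  by apply/measurable_EFinP; exact: measurable_normal_pdf.
have g0 x : 0 <= g x by rewrite mule_ge0// lee_fin normal_pdf_ge0.
transitivity (\int[mu]_x g (- x)%R).
  by apply: eq_integral => x _; rewrite /g normal_pdfN.
transitivity
  (\int[pushforward mu (-%R : _ -> measurableTypeR R)]_(x in setT) g x).
  by rewrite ge0_integral_pushforward.
by apply: eq_measure_integral => A mA _; exact: lebesgue_measureN.
Qed.

(** For y = x^2 / (4 s^2), the bound y exp(- y) <= 1 absorbs the factor x^2 into
    half of the exponent. What remains is 4 s^2 times a Gaussian density of
    deviation sqrt 2 s, up to the ratio sqrt 2 <= 2 of the two peaks. *)
Lemma normal_second_moment_le s : (0 < s)%R ->
  \int[normal_prob 0 s]_x (x ^+ 2)%:E <= (8 * s ^+ 2)%:E.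
Proof.
move=> s0.
have s0' : s != 0%R by rewrite gt_eqF.
pose c : R := Num.sqrt 2.
have c0 : (0 < c)%R by rewrite sqrtr_gt0.
have c2 : (c ^+ 2 = 2)%R by rewrite sqr_sqrtr.
have cle2 : (c <= 2)%R by nra.
pose r := (c * s)%R.
have r0 : (0 < r)%R by rewrite mulr_gt0.
have r0' : r != 0%R by rewrite gt_eqF.
rewrite ge0_integral_normal_prob; first last.
- by move=> x; rewrite lee_fin sqr_ge0.
- by apply/measurable_EFinP; exact: measurable_funX.
have pk : (normal_peak s = c * normal_peak r)%R.
  have E : ((c * s) ^+ 2 * pi *+ 2 = c ^+ 2 * (s ^+ 2 * pi *+ 2))%R by ring.
  rewrite /normal_peak /r E sqrtrM ?sqr_ge0// sqrtr_sqr gtr0_norm//.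
  by rewrite invfM mulrA divff ?mul1r// gt_eqF.
have pw (x : R) :
    (x ^+ 2 * normal_pdf 0 s x <= 8 * s ^+ 2 * normal_pdf 0 r x)%R.
  rewrite !normal_pdfE// /normal_fun !subr0 pk.
  set y := (x ^+ 2 / (4 * s ^+ 2))%R.
  have y0 : (0 <= y)%R by rewrite divr_ge0 ?sqr_ge0// mulr_ge0// sqr_ge0.
  have ->: (- x ^+ 2 / (s ^+ 2 *+ 2) = - y - y)%R.
    by rewrite /y; field.
  have ->: (- x ^+ 2 / (r ^+ 2 *+ 2) = - y)%R.
    by rewrite /y /r exprMn c2; field.
  have -> : (x ^+ 2 = 4 * s ^+ 2 * y)%R by rewrite /y; field.
  have ye : (y * expR (- y) <= 1)%R.
    rewrite expRN ler_pdivrMr ?expR_gt0// mul1r.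
    by apply: le_trans (expR_ge1Dx y); rewrite lerDr.
  rewrite expRD.
  have pr := normal_peak_ge0 r; have e0 := expR_ge0 (- y).
  have -> : (4 * s ^+ 2 * y * (c * normal_peak r * (expR (- y) * expR (- y)))
    = (y * expR (- y)) * (4 * c * s ^+ 2 * (normal_peak r * expR (- y))))%R
    by ring.
  have A : (0 <= normal_peak r * expR (- y))%R by rewrite mulr_ge0.
  apply: (@le_trans _ _ (4 * c * s ^+ 2 * (normal_peak r * expR (- y))))%R.
    by rewrite ler_piMl// !mulr_ge0 ?sqr_ge0// ltW.
  by rewrite ler_wpM2r// ler_wpM2r ?sqr_ge0//; lra.
apply: (@le_trans _ _
   (\int[mu]_x ((8 * s ^+ 2)%:E * (normal_pdf 0 r x)%:E))).
  apply: ge0_le_integral => //.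
  - by move=> x _; rewrite mule_ge0// lee_fin ?sqr_ge0// normal_pdf_ge0.
  - apply/measurable_EFinP; apply: measurable_funM => //.
    exact: measurable_normal_pdf.
  - apply/measurable_EFinP; apply: measurable_funM => //.
    exact: measurable_normal_pdf.
  - by move=> x _; rewrite -!EFinM lee_fin; exact: pw.
rewrite ge0_integralZl//; first last.
- by rewrite lee_fin mulr_ge0// sqr_ge0.
- by move=> x _; rewrite lee_fin normal_pdf_ge0.
- by apply/measurable_EFinP; exact: measurable_normal_pdf.
by rewrite integral_normal_pdf mule1.
Qed.

(** Averaging the integrand over x and - x removes the cross term 2 m h x. *)
Lemma normal_affine_sqr_le s m h : (0 < s)%R ->
  \int[normal_prob 0 s]_x ((m + h * x) ^+ 2)%:E <=
  (m ^+ 2 + 8 * s ^+ 2 * h ^+ 2)%:E.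
Proof.
move=> s0; have s0' : s != 0%R by rewrite gt_eqF.
pose f (x : R) := ((m + h * x) ^+ 2)%:E.
have mf : measurable_fun setT f.
  by apply/measurable_EFinP/measurable_funX/measurable_funD.
have f0 x : 0 <= f x by rewrite lee_fin sqr_ge0.
have mfN : measurable_fun setT (fun x : R => f (- x)%R).
  by apply: measurableT_comp => //; exact: oppr_measurable.
have H : \int[normal_prob 0 s]_x f x + \int[normal_prob 0 s]_x f x =
         \int[normal_prob 0 s]_x (2 * m ^+ 2)%:E +
         (2 * h ^+ 2)%:E * \int[normal_prob 0 s]_x (x ^+ 2)%:E.
  have c0 (c : R) : 0 <= (2 * c ^+ 2)%:E.
    by rewrite lee_fin pmulr_rge0// sqr_ge0.
  have x0 (x : R) : 0 <= (x ^+ 2)%:E by rewrite lee_fin sqr_ge0.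
  have mx : measurable_fun setT (fun x : R => (x ^+ 2)%:E).
    exact/measurable_EFinP/measurable_funX.
  rewrite -{2}(ge0_integral_normal_probN s0' mf f0) -ge0_integralD//.
  rewrite -ge0_integralZl// -ge0_integralD//; first last.
  - exact: measurable_funeM.
  - by move=> x _; exact: mule_ge0.
  by apply: eq_integral => x _; rewrite /f -EFinM -!EFinD; congr EFin; ring.
rewrite integral_cst//= probability_setT mule1 in H.
have fin2 : \int[normal_prob 0 s]_x (x ^+ 2)%:E \is a fin_num.
  rewrite ge0_fin_numE; last first.
    by apply: integral_ge0 => x _; rewrite lee_fin sqr_ge0.
  exact: le_lt_trans (normal_second_moment_le s0) (ltry _).
have := normal_second_moment_le s0; move: H; rewrite -/f.
rewrite -(fineK fin2); set q := fine _; rewrite -EFinM -EFinD lee_fin => H le.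
have finf : \int[normal_prob 0 s]_x f x \is a fin_num.
  rewrite ge0_fin_numE; last exact: integral_ge0.
  have : \int[normal_prob 0 s]_x f x + \int[normal_prob 0 s]_x f x < +oo.
    by rewrite H ltry.
  apply: le_lt_trans; rewrite leeDl//; exact: integral_ge0.
rewrite -(fineK finf) -EFinD in H *; set I := fine _ in H *.
case: H => H; rewrite lee_fin.
have h2 : (0 <= h ^+ 2)%R by exact: sqr_ge0.
have : (h ^+ 2 * q <= h ^+ 2 * (8 * s ^+ 2))%R by rewrite ler_wpM2l.
by move: H; lra.
Qed.

End Gaussian.

(** * Brownian increments and the past *)
Section Independence.
Context (R : realType) (d : measure_display) (Omega : measurableType d).
Context (P : probability Omega R).
Local Open Scope ereal_scope.

(** Independence makes the joint law of Y and D a product measure, so that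
    Tonelli applies. *)
Lemma ge0_integral_independent_pair d1 (T1 : measurableType d1)
    d2 (T2 : measurableType d2)
    (Y : {mfun Omega >-> T1}) (D : {mfun Omega >-> T2})
    (g : T1 * T2 -> \bar R) :
  (forall A C, measurable A -> measurable C ->
     P (Y @^-1` A `&` D @^-1` C) = P (Y @^-1` A) * P (D @^-1` C)) ->
  measurable_fun setT g -> (forall x, 0 <= g x) ->
  \int[P]_w g (Y w, D w) =
  \int[P]_w \int[distribution P D]_z g (Y w, z).
Proof.
move=> ind mg g0.
have mYD : measurable_fun setT (fun w => (Y w, D w)).
  by apply/measurable_fun_pairP; split; exact: measurable_funP.
pose YD : {mfun Omega >-> (T1 * T2)%type} :=
  HB.pack (fun w => (Y w, D w)) (isMeasurableFun.Build _ _ _ _ _ mYD).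
have -> : \int[P]_w g (Y w, D w) = \int[distribution P YD]_x g x.
  by rewrite /distribution ge0_integral_pushforward.
have -> : \int[distribution P YD]_x g x =
    \int[product_measure1 (distribution P Y) (distribution P D)]_x g x.
  apply: eq_measure_integral => A mA _; apply/esym.
  exact: product_measure_unique.
rewrite fubini_tonelli1// /distribution ge0_integral_pushforward//.
exact: measurable_fun_fubini_tonelli_F.
by move=> y _; apply: integral_ge0.
Qed.

(** Both sides are finite measures in A, and they agree on a system of
    generators that is closed under intersection. *)
Lemma independent_sigma_generated (G1 : set (set Omega)) (D : set Omega) :
  setI_closed G1 -> G1 `<=` measurable -> G1 setT -> measurable D ->
  (forall A, G1 A -> P (A `&` D) = P A * P D) ->
  forall A, <<s G1 >> A -> P (A `&` D) = P A * P D.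
Proof.
move=> IG mG GT mD ind A sA.
have PD0 : (0 <= fine (P D))%R by exact: fine_ge0.
have fD : P D \is a fin_num by exact: fin_num_measure.
pose m2 := mscale (NngNum PD0) P.
have m2E E : m2 E = P E * P D by rewrite /m2 /mscale /= fineK// muleC.
rewrite -m2E -[LHS]/(mrestr P mD A).
apply: (@g_sigma_algebra_measure_unique _ _ _ G1 mG (fun=> setT)) => //.
- by rewrite bigcup_const//; exists 0%N.
- move=> E GE; transitivity (P E * P D); last exact: (esym (m2E E)).
  exact: ind.
- move=> _; change (mrestr P mD setT < +oo); rewrite /mrestr.
  apply: le_lt_trans (ltry 1).
  exact: probability_le1 (measurableI _ _ measurableT mD).
Qed.

(** Makes the closure properties of measurable functions available for
    measurability with respect to a sub-sigma-algebra. *)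
Lemma measurable_wrtP (G : set (set Omega)) (h : Omega -> R) :
  measurable_wrt <<s G >> h <->
  measurable_fun (setT : set (g_sigma_algebraType G)) h.
Proof.
split=> [mh _ Y mY|mh Y mY]; first by rewrite setTI; exact: mh.
by rewrite -[X in <<s G >> X]setTI; exact: mh.
Qed.

Lemma measurable_wrt_sub (G : set (set Omega)) (h : Omega -> R) :
  G `<=` measurable -> measurable_wrt G h -> measurable_fun setT h.
Proof. by move=> sG mh _ Y mY; rewrite setTI; exact/sG/mh. Qed.

Context (B : R -> Omega -> R) (X0 : Omega -> R).
Hypothesis BM : standard_brownian_motion P B.
Hypothesis mX0 : measurable_fun setT X0.

Let mB t : (0 <= t)%R -> measurable_fun setT (B t).
Proof. by case: BM => + _ _ _ _; apply. Qed.

Lemma sigma_of_measurable (D : set R) : (forall u, D u -> (0 <= u)%R) ->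
  sigma_of D B `<=` measurable.
Proof.
move=> D0; apply: smallest_sub; first exact: sigma_algebra_measurable.
move=> A [u Du [C mC <-]]; exact: mB (D0 _ Du) _ _ mC.
Qed.

Lemma filtration_measurable t : filtration X0 B t `<=` measurable.
Proof.
apply: smallest_sub; first exact: sigma_algebra_measurable.
move=> A [[C mC <-]|]; first exact: mX0.
apply: sigma_of_measurable => u /=; rewrite in_itv/=; by case/andP.
Qed.

Lemma filtration_mono r t : (r <= t)%R ->
  filtration X0 B r `<=` filtration X0 B t.
Proof.
move=> rt; apply: sub_sigma_algebra2; apply: setUS.
apply: sub_sigma_algebra2 => A [u /=]; rewrite in_itv/= => /andP[u0 ur] Au.
by exists u => //=; rewrite in_itv/= u0 (le_trans ur).
Qed.

Hypothesis ind0 : independent_sigma P (preimage_set_system setT X0 measurable)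
    (sigma_of `[0%R, +oo[ B).

(** The sets A `&` C, with A in the sigma-algebra of X0 and C in that of B up to
    time r, generate the filtration at r and are closed under intersection. On
    them the product rule combines the independence of X0 from the whole of B
    with the independence of the increment from B up to r. *)
Lemma increment_independent_filtration r t : (0 <= r)%R -> (r < t)%R ->
  independent_sigma P (filtration X0 B r)
    (preimage_set_system setT (fun w => B t w - B r w)%R measurable).
Proof.
move=> r0 rt A1 A2 FA1 [C mC <-].
set D := setT `&` _.
have t0 : (0 <= t)%R by rewrite (le_trans r0)// ltW.
have mD : measurable D.
  have mBB : measurable_fun setT (fun w => B t w - B r w)%R.
    by apply: measurable_funB; exact: mB.
  exact: mBB.
pose S := sigma_of `[0%R, +oo[ B.
pose genB (I : set R) :=
  \bigcup_(u in I) preimage_set_system setT (B u) measurable.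
have SB u : (0 <= u)%R ->
    measurable_fun (setT : set (g_sigma_algebraType (genB `[0%R, +oo[%classic)))
      (B u).
  move=> u0; apply/measurable_wrtP => Y mY; apply: sub_sigma_algebra.
  by exists u; [rewrite /= in_itv/= u0|exists Y => //; rewrite setTI].
have SD : S D.
  have : measurable_fun
      (setT : set (g_sigma_algebraType (genB `[0%R, +oo[%classic)))
     (fun w => B t w - B r w)%R by apply: measurable_funB; exact: SB.
  by move/(_ measurableT C mC).
have sS : sigma_of `[0%R, r] B `<=` S.
  apply: sub_sigma_algebra2 => E [u /=]; rewrite in_itv/= => /andP[u0 ur] Eu.
  by exists u => //=; rewrite in_itv/= u0.
have IS (E F : set Omega) : S E -> S F -> S (E `&` F).
  exact: (@measurableI _ (g_sigma_algebraType (genB `[0%R, +oo[%classic))).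
pose G : set (set Omega) := [set E | exists A C,
  [/\ preimage_set_system setT X0 measurable A, sigma_of `[0%R, r] B C
    & E = A `&` C]].
have XT : preimage_set_system setT X0 measurable setT.
  by exists setT => //; rewrite preimage_setT setTI.
have sBT : sigma_of `[0%R, r] B setT.
  exact: (@measurableT _ (g_sigma_algebraType (genB `[0%R, r]%classic))).
have mr : sigma_of `[0%R, r] B `<=` measurable.
  by apply: sigma_of_measurable => u /=; rewrite in_itv/= => /andP[].
apply: (@independent_sigma_generated G) => //.
- move=> _ _ [A [E [XA BE ->]]] [A' [E' [XA' BE' ->]]].
  exists (A `&` A'), (E `&` E'); split; last by rewrite setIACA.
    case: XA XA' => [Y mY <-] [Y' mY' <-]; exists (Y `&` Y').
      exact: measurableI.
    by rewrite !setTI preimage_setI.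
  exact: (@measurableI _ (g_sigma_algebraType (genB `[0%R, r]%classic))).
- move=> _ [A [E [[Y mY <-] BE ->]]]; apply: measurableI; first exact: mX0.
  exact: mr.
- by exists setT, setT; split=> //; rewrite setTI.
- move=> _ [A [E [XA BE ->]]].
  rewrite -setIA ind0//; last by apply: IS => //; exact: sS.
  rewrite (ind0 XA (sS _ BE)).
  have [_ _ _ _ /(_ r t r0 rt E D BE)] := BM.
  by rewrite -muleA => ->//; exists C.
- apply: sub_sigma_algebra2 FA1 => E [XE|BE].
    by exists E, setT; split=> //; rewrite setIT.
  by exists setT, E; split=> //; rewrite setTI.
Qed.

(** One step of the Ito isometry, as an inequality. The pair (M, h) is
    independent of the increment, so that the expectation can be taken over
    the increment alone, with M and h frozen. *)
Lemma increment_sqr_le r t (M h : Omega -> R) : (0 <= r)%R -> (r <= t)%R ->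
  measurable_wrt (filtration X0 B r) M ->
  measurable_wrt (filtration X0 B r) h ->
  \int[P]_w ((M w + h w * (B t w - B r w)) ^+ 2)%:E <=
  \int[P]_w (M w ^+ 2 + 8 * (t - r) * h w ^+ 2)%:E.
Proof.
move=> r0; rewrite le_eqVlt => /predU1P[<- mM mh|rt mM mh].
  rewrite le_eqVlt; apply/orP; left; apply/eqP; apply: eq_integral => w _.
  by rewrite !subrr !mulr0 mul0r !addr0.
have t0 : (0 <= t)%R by rewrite (le_trans r0)// ltW.
have mD : measurable_fun setT
    ((fun w => B t w - B r w)%R : Omega -> measurableTypeR R).
  by apply: measurable_funB; exact: mB.
pose D : {mfun Omega >-> measurableTypeR R} :=
  HB.pack ((fun w => B t w - B r w)%R : Omega -> measurableTypeR R)
    (isMeasurableFun.Build _ _ _ _ _ mD).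
have mY : measurable_fun (setT : set (g_sigma_algebraType
   (preimage_set_system setT X0 measurable `|` sigma_of `[0%R, r] B)))
     (fun w => (M w, h w)).
  by apply/measurable_fun_pairP; split; exact/measurable_wrtP.
have FY A : measurable A -> filtration X0 B r ((fun w => (M w, h w)) @^-1` A).
  by move=> mA; have := mY measurableT A mA; rewrite setTI.
have mY' : measurable_fun setT (fun w => (M w, h w)).
  by move=> _ A mA; rewrite setTI; exact: (filtration_measurable (FY A mA)).
pose Y : {mfun Omega >-> (R * R)%type} :=
  HB.pack (fun w => (M w, h w)) (isMeasurableFun.Build _ _ _ _ _ mY').
pose g (x : (R * R) * measurableTypeR R) := ((x.1.1 + x.1.2 * x.2) ^+ 2)%:E.
have mg : measurable_fun setT g.
  apply/measurable_EFinP/measurable_funX/measurable_funD.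
    exact: measurableT_comp.
  apply: measurable_funM; first exact: measurableT_comp.
  exact: (measurable_snd : measurable_fun setT
    (snd : (R * R) * measurableTypeR R -> measurableTypeR R)).
have g0 x : 0 <= g x by rewrite lee_fin sqr_ge0.
have ind A C : measurable A -> measurable C ->
    P (Y @^-1` A `&` D @^-1` C) = P (Y @^-1` A) * P (D @^-1` C).
  move=> mA mC; apply: (increment_independent_filtration r0 rt).
    exact: FY.
  by exists C => //; rewrite setTI.
rewrite -[leLHS]/(\int[P]_w g (Y w, D w)).
rewrite (ge0_integral_independent_pair ind mg g0).
apply: ge0_le_integral => //.
- by move=> w _; exact: integral_ge0.
- have mF := @measurable_fun_fubini_tonelli_F
    _ _ _ _ _ (distribution P D) _ mg g0.
  exact: (measurableT_comp mF mY').
- apply/measurable_EFinP/measurable_funD.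
    exact/measurable_funX/(measurable_wrt_sub _ mM)/filtration_measurable.
  apply: measurable_funM => //.
  exact/measurable_funX/(measurable_wrt_sub _ mh)/filtration_measurable.
- move=> w _.
  have s0 : (0 < Num.sqrt (t - r))%R by rewrite sqrtr_gt0 subr_gt0.
  have E : (Num.sqrt (t - r) ^+ 2 = t - r)%R.
    by rewrite sqr_sqrtr// subr_ge0 ltW.
  have := normal_affine_sqr_le (M w) (h w) s0; rewrite E; apply: le_trans.
  rewrite le_eqVlt; apply/orP; left; apply/eqP.
  change (\int[distribution P D]_z g (Y w, z) =
    \int[normal_prob 0 (Num.sqrt (t - r))]_z g (Y w, z)).
  apply: eq_measure_integral => A mA _.
  by have [_ _ _ /(_ r t r0 rt A mA)] := BM.
Qed.

End Independence.

(** * Simple processes and their energy *)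
Section SimpleProcesses.
Context (R : realType) (d : measure_display) (Omega : measurableType d).
Local Notation mu := lebesgue_measure.
Implicit Types (F : R -> set (set Omega)) (a b t : R).
Implicit Types (H : @simple_process R d Omega).

(** The integral of the square of H over its first k intervals. *)
Definition sp_energy H (k : nat) (w : Omega) : R :=
  \sum_(i < k) sp_coef H i w ^+ 2 * (sp_time H i.+1 - sp_time H i).

Lemma sp_time_mono F a b H i j : simple_process_on F a b H ->
  (i <= j)%N -> (j <= sp_size H)%N -> sp_time H i <= sp_time H j.
Proof.
move=> [_ _ mono _ _]; elim: j => [|j IH]; first by rewrite leqn0 => /eqP->.
rewrite leq_eqVlt => /predU1P[->//|ij jn].
by apply: le_trans (IH _ (ltnW jn)) (mono j jn).
Qed.

Lemma sp_time_ge F a b H i : simple_process_on F a b H ->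
  (i <= sp_size H)%N -> a <= sp_time H i.
Proof.
move=> HP ni; have [<- _ _ _ _] := HP; exact: sp_time_mono HP _ _.
Qed.

Lemma sp_time_le F a b H i : simple_process_on F a b H ->
  (i <= sp_size H)%N -> sp_time H i <= b.
Proof.
move=> HP ni; have [_ <- _ _ _] := HP; exact: sp_time_mono HP _ _.
Qed.

Lemma sp_energy_mono F a b H i j w : simple_process_on F a b H ->
  (i <= j)%N -> (j <= sp_size H)%N -> sp_energy H i w <= sp_energy H j w.
Proof.
move=> [_ _ mono _ _]; elim: j => [|j IH]; first by rewrite leqn0 => /eqP->.
rewrite leq_eqVlt => /predU1P[->//|ij jn].
apply: le_trans (IH _ (ltnW jn)) _ => //.
rewrite [leRHS]/sp_energy big_ord_recr/= lerDl mulr_ge0 ?sqr_ge0//.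
by rewrite subr_ge0 mono.
Qed.

Lemma sp_valueE F a b H i t w : simple_process_on F a b H ->
  (i < sp_size H)%N -> sp_time H i < t <= sp_time H i.+1 ->
  sp_value H t w = sp_coef H i w.
Proof.
move=> HP ni /andP[it ti]; rewrite /sp_value.
rewrite (bigD1 (Ordinal ni))//= indicE mem_set/=; last by rewrite in_itv/= it.
rewrite mulr1 big1 ?addr0// => j ji; rewrite indicE memNset ?mulr0//=.
rewrite in_itv/= => /andP[jt tj].
have {}ji : val j != i by apply: contra ji => /eqP E; apply/eqP/val_inj.
have [lt|] := ltnP j i.
  by have := sp_time_mono HP lt (ltnW ni); rewrite leNgt (lt_le_trans it tj).
rewrite leq_eqVlt eq_sym (negbTE ji)/= => lt.
have := sp_time_mono HP lt (ltnW (ltn_ord j)).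
by rewrite leNgt (lt_le_trans jt ti).
Qed.

Lemma sp_value_outside F a b H t w : simple_process_on F a b H ->
  (t <= a) || (b < t) -> sp_value H t w = 0.
Proof.
move=> HP tab; rewrite /sp_value big1// => i _.
rewrite indicE memNset ?mulr0//= in_itv/= => /andP[it ti].
have := sp_time_ge HP (ltnW (ltn_ord i)); have := sp_time_le HP (ltn_ord i).
case/orP: tab => [ta|bt] ib ai.
  by have := lt_le_trans it ta; rewrite ltNge ai.
by have := le_lt_trans ib bt; rewrite ltNge ti.
Qed.

Lemma sp_value_sqr F a b H t w : simple_process_on F a b H ->
  sp_value H t w ^+ 2 = \sum_(i < sp_size H)
    sp_coef H i w ^+ 2 * \1_(`]sp_time H i, sp_time H i.+1]) t.
Proof.
move=> HP.
have [[i it]|nit] := pselect (exists i : 'I_(sp_size H),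
    sp_time H i < t <= sp_time H i.+1).
  rewrite (sp_valueE w HP (ltn_ord i) it) (bigD1 i)//=.
  rewrite indicE mem_set/=; last by rewrite in_itv.
  rewrite mulr1 big1 ?addr0// => j ji; rewrite indicE memNset ?mulr0//=.
  rewrite in_itv/= => jt; move: ji => /negP; apply; apply/eqP/val_inj => /=.
  case/andP: it => it ti; case/andP: jt => jt tj.
  case: (ltngtP j i) => // lt.
    have := sp_time_mono HP lt (ltnW (ltn_ord i)).
    by rewrite leNgt (lt_le_trans it tj).
  have := sp_time_mono HP lt (ltnW (ltn_ord j)).
  by rewrite leNgt (lt_le_trans jt ti).
rewrite /sp_value !big1 ?expr0n// => i _; rewrite indicE memNset ?mulr0//=;
  by rewrite in_itv/= => it; apply: nit; exists i.
Qed.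

Lemma integral_sp_value_sqr F a b H w : simple_process_on F a b H ->
  (\int[mu]_(t in `[a, b]) (sp_value H t w ^+ 2)%:E)%E =
  (sp_energy H (sp_size H) w)%:E.
Proof.
move=> HP.
under eq_integral do rewrite (sp_value_sqr _ w HP) -sumEFin.
rewrite ge0_integral_sum//; first last.
- by move=> i t _; rewrite lee_fin mulr_ge0// sqr_ge0.
- by move=> i; apply/measurable_EFinP/measurable_funM.
rewrite /sp_energy -sumEFin; apply: eq_bigr => i _.
under eq_integral do rewrite EFinM.
rewrite ge0_integralZl//; first last.
- by rewrite lee_fin sqr_ge0.
- by apply/measurable_EFinP.
rewrite integral_indic// [RHS]EFinM; congr mule.
rewrite setIidl; last first.
  move=> t /=; rewrite !in_itv/= => /andP[it ti].
  rewrite (le_trans (sp_time_ge HP (ltnW (ltn_ord i))) (ltW it)).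
  by rewrite (le_trans ti (sp_time_le HP (ltn_ord i))).
rewrite [LHS]lebesgue_measure_itv/= lte_fin.
have : sp_time H i <= sp_time H i.+1 by apply: sp_time_mono HP _ _.
by rewrite le_eqVlt => /predU1P[->|->//]; rewrite ltxx subrr.
Qed.

Lemma measurable_sp_value H w D :
  measurable_fun D (fun t => sp_value H t w).
Proof.
apply/measurable_funTS; apply: measurable_sum => i.
by apply: measurable_funM => //; exact: measurable_indic.
Qed.

End SimpleProcesses.

(** * Integrals of simple processes of small energy *)
Section ItoEstimate.
Context (R : realType) (d : measure_display) (Omega : measurableType d).
Context (P : probability Omega R) (B : R -> Omega -> R) (X0 : Omega -> R).
Hypothesis BM : standard_brownian_motion P B.
Hypothesis mX0 : measurable_fun setT X0.
Hypothesis ind0 : independent_sigma P (preimage_set_system setT X0 measurable)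
    (sigma_of `[0%R, +oo[ B).
Local Notation F := (filtration X0 B).
Implicit Types (a b t : R) (H : @simple_process R d Omega).

Lemma adapted_measurable t (h : Omega -> R) :
  measurable_wrt (F t) h -> measurable_fun setT h.
Proof.
by apply: measurable_wrt_sub => A; exact: (filtration_measurable BM mX0).
Qed.

Lemma measurable_wrt_le r t (h : Omega -> R) : r <= t ->
  measurable_wrt (F r) h -> measurable_wrt (F t) h.
Proof. by move=> rt mh Y mY; apply: filtration_mono rt _ _; exact: mh. Qed.

Lemma measurable_wrt_B r t : 0 <= r -> r <= t -> measurable_wrt (F t) (B r).
Proof.
move=> r0 rt Y mY; apply: sub_sigma_algebra; right; apply: sub_sigma_algebra.
exists r; first by rewrite /= in_itv/= r0.
by exists Y => //; rewrite setTI.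
Qed.

(** The Ito isometry as an inequality, by induction on the number of intervals;
    each step uses that the sum so far is measurable at the time reached. *)
Lemma sp_partial_sums a b H k : 0 <= a -> simple_process_on F a b H ->
  (k <= sp_size H)%N ->
  let M w := \sum_(i < k)
    sp_coef H i w * (B (sp_time H i.+1) w - B (sp_time H i) w) in
  measurable_wrt (F (sp_time H k)) M /\
  (\int[P]_w (M w ^+ 2)%:E <= \int[P]_w (8 * sp_energy H k w)%:E)%E.
Proof.
move=> a0 HP; have [_ _ mono mh _] := HP.
elim: k => [|k IH] kn /=.
  split.
    under eq_fun do rewrite big_ord0.
    exact/measurable_wrtP.
  rewrite le_eqVlt; apply/orP; left; apply/eqP; apply: eq_integral => w _.
  by rewrite /sp_energy !big_ord0 expr0n mulr0.
have [mM IHM] := IH (ltnW kn).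
set M := (fun w => _) in mM IHM.
have tk0 : 0 <= sp_time H k by apply: le_trans a0 (sp_time_ge HP (ltnW kn)).
have mhk := mh k kn.
split.
  under eq_fun do rewrite big_ord_recr/=.
  have := measurable_wrt_le (mono k kn) mM; move/measurable_wrtP => mM'.
  have := measurable_wrt_le (mono k kn) mhk; move/measurable_wrtP => mh'.
  have tk1 := le_trans tk0 (mono k kn).
  have /measurable_wrtP mB1 := measurable_wrt_B tk1 (lexx _).
  have /measurable_wrtP mB0 := measurable_wrt_B tk0 (mono k kn).
  apply/measurable_wrtP; apply: measurable_funD => //.
  by apply: measurable_funM => //; exact: measurable_funB.
under eq_integral do rewrite big_ord_recr/=.
have mM' : measurable_fun setT M.
  exact: adapted_measurable mM.
have mh' : measurable_fun setT (sp_coef H k).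
  exact: adapted_measurable mhk.
have me : measurable_fun setT (sp_energy H k).
  apply: measurable_sum => i; apply: measurable_funM => //.
  apply/measurable_funX.
  have ni : (i < sp_size H)%N by rewrite (ltn_trans (ltn_ord i)).
  exact: adapted_measurable (mh i ni).
have e0 w : 0 <= sp_energy H k w.
  apply: sumr_ge0 => i _; rewrite mulr_ge0 ?sqr_ge0// subr_ge0 mono//.
  by rewrite (ltn_trans (ltn_ord i)).
have D0 : 0 <= sp_time H k.+1 - sp_time H k by rewrite subr_ge0 mono.
apply: le_trans (increment_sqr_le BM mX0 ind0 tk0 (mono k kn) mM mhk) _.
under eq_integral do rewrite EFinD.
have Ek w : (8 * sp_energy H k.+1 w)%:E = ((8 * sp_energy H k w)%:E +
    (8 * (sp_time H k.+1 - sp_time H k) * sp_coef H k w ^+ 2)%:E)%E.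
  rewrite -EFinD /sp_energy big_ord_recr/=; congr EFin; ring.
under [leRHS]eq_integral do rewrite Ek.
have q0 w :
    (0 <= (8 * (sp_time H k.+1 - sp_time H k) * sp_coef H k w ^+ 2)%:E)%E.
  by rewrite lee_fin; apply: mulr_ge0; [exact: mulr_ge0|exact: sqr_ge0].
have mq : measurable_fun setT (fun w =>
    (8 * (sp_time H k.+1 - sp_time H k) * sp_coef H k w ^+ 2)%:E).
  by apply/measurable_EFinP/measurable_funM => //; exact: measurable_funX.
have M0 w : (0 <= (M w ^+ 2)%:E)%E by rewrite lee_fin sqr_ge0.
have mM2 : measurable_fun setT (fun w => (M w ^+ 2)%:E).
  exact/measurable_EFinP/measurable_funX.
have e80 w : (0 <= (8 * sp_energy H k w)%:E)%E by rewrite lee_fin mulr_ge0.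
have me8 : measurable_fun setT (fun w => (8 * sp_energy H k w)%:E).
  exact/measurable_EFinP/measurable_funM.
by rewrite !ge0_integralD// leeD2r.
Qed.

(** The test for interval i includes the energy on interval i itself: it only
    involves coefficients known at the left end of that interval, so that the
    truncated process is still adapted. *)
Definition sp_truncate (c : R) H : @simple_process R d Omega :=
  SimpleProcess (sp_size H) (sp_time H)
    (fun i w => sp_coef H i w * \1_`]-oo, c] (sp_energy H i.+1 w)).

Lemma sp_energy_measurable a b H i : simple_process_on F a b H ->
  (i < sp_size H)%N ->
  measurable_wrt (F (sp_time H i)) (sp_energy H i.+1).
Proof.
move=> HP ni; apply/measurable_wrtP.
apply: measurable_sum => j; apply: measurable_funM => //.
apply: measurable_funX; apply/measurable_wrtP.
have [_ _ _ mh _] := HP.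
apply: measurable_wrt_le (mh j _).
  by apply: (sp_time_mono HP); [rewrite -ltnS|exact: ltnW].
by rewrite (leq_ltn_trans _ ni)// -ltnS.
Qed.

Lemma sp_truncate_on a b c H : simple_process_on F a b H ->
  simple_process_on F a b (sp_truncate c H).
Proof.
move=> HP; have [Ha Hb mono mh bh] := HP; split => //= i ni.
  apply/measurable_wrtP; apply: measurable_funM.
    by apply/measurable_wrtP; exact: mh.
  have /measurable_wrtP := sp_energy_measurable HP ni.
  by apply: measurableT_comp; exact: measurable_indic.
have [C hC] := bh i ni; exists C => w.
rewrite normrM indicE; apply: le_trans (hC w).
by rewrite ler_piMr//; case: (_ \in _); rewrite ?normr1 ?normr0.
Qed.

(** The energy is nondecreasing in k, so that truncation removes a final segment
    of the intervals. *)
Lemma sp_truncate_energy a b c H w k : 0 <= c -> simple_process_on F a b H ->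
  (k <= sp_size H)%N -> sp_energy (sp_truncate c H) k w <= c.
Proof.
move=> c0 HP.
suff S : (k <= sp_size H)%N -> sp_energy (sp_truncate c H) k w <= c /\
    sp_energy (sp_truncate c H) k w <= sp_energy H k w by move=> /S[].
elim: k => [|k IH] kn; first by rewrite /sp_energy !big_ord0.
have [IH1 IH2] := IH (ltnW kn).
have [_ _ mono _ _] := HP.
have D0 : 0 <= sp_coef H k w ^+ 2 * (sp_time H k.+1 - sp_time H k).
  by rewrite mulr_ge0 ?sqr_ge0// subr_ge0 mono.
have E : sp_energy H k.+1 w =
   sp_energy H k w + sp_coef H k w ^+ 2 * (sp_time H k.+1 - sp_time H k).
  by rewrite /sp_energy big_ord_recr.
rewrite [sp_energy (sp_truncate c H) k.+1 w]/sp_energy big_ord_recr/=.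
rewrite -/(sp_energy (sp_truncate c H) k w) indicE.
have [/set_mem/=|_] := boolP (_ \in _).
  rewrite in_itv/= E mulr1 => le; split; last by rewrite lerD2r.
  by apply: le_trans le; rewrite lerD2r.
rewrite mulr0 expr0n mul0r addr0 E; split => //.
by apply: le_trans IH2 _; rewrite lerDl.
Qed.

Lemma sp_truncate_integral a b c H w : simple_process_on F a b H ->
  sp_energy H (sp_size H) w <= c ->
  sp_integral B (sp_truncate c H) w = sp_integral B H w.
Proof.
move=> HP le.
apply: eq_bigr => i _ /=; congr (_ * _); rewrite indicE mem_set ?mulr1//=.
by rewrite in_itv/=; apply: le_trans le; exact: sp_energy_mono HP _ _.
Qed.

(** Off A, truncation at level c changes nothing, while the truncated integral
    has second moment at most 8 c, so that Chebyshev applies to it. *)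
Lemma sp_integral_small a b (e c : R) H (A : set Omega) :
  0 <= a -> 0 < e -> 0 <= c -> simple_process_on F a b H ->
  measurable A ->
  (forall w, ~ A w -> sp_energy H (sp_size H) w <= c) ->
  exists A' : set Omega, [/\ measurable A',
    (P A' <= P A + (8 * c / e ^+ 2)%:E)%E &
    forall w, ~ A' w -> `|sp_integral B H w| < e].
Proof.
move=> a0 e0 c0 HP mA Ac.
have HP' := sp_truncate_on c HP.
have [mM le] := sp_partial_sums a0 HP' (leqnn _).
set M := (fun w => _) in mM le.
have {}mM : measurable_fun setT M.
  exact: adapted_measurable mM.
pose g w := (M w ^+ 2)%:E.
have mg : measurable_fun setT g by exact/measurable_EFinP/measurable_funX.
have e20 : 0 < e ^+ 2 by rewrite exprn_gt0.
pose E := setT `&` [set w | ((e ^+ 2)%:E <= `|g w|)%E].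
have mE : measurable E.
  apply: emeasurable_fun_c_infty => //; exact: measurableT_comp.
exists (A `|` E); split.
- exact: measurableU.
- apply: le_trans (measureU2 _ mA mE) _; rewrite leeD2l//.
  have := le_integral_abse P measurableT mg e20; rewrite -/E => cheb.
  rewrite -(@lee_pmul2l _ (e ^+ 2)%:E)// -EFinM.
  have -> : e ^+ 2 * (8 * c / e ^+ 2) = 8 * c by field; rewrite gt_eqF.
  apply: le_trans cheb _.
  under eq_integral do rewrite gee0_abs ?lee_fin ?sqr_ge0//.
  apply: le_trans le _.
  apply: (@le_trans _ _ (\int[P]_w (8 * c)%:E)%E).
    apply: ge0_le_integral => //.
    - move=> w _; rewrite lee_fin mulr_ge0// sumr_ge0// => i _.
      by rewrite mulr_ge0 ?sqr_ge0// subr_ge0; case: HP => _ _ + _ _; apply.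
    - apply/measurable_EFinP/measurable_funM => //.
      apply: measurable_sum => i; apply: measurable_funM => //.
      apply: measurable_funX; case: HP' => _ _ _ mh _.
      exact: adapted_measurable (mh i (ltn_ord i)).
    - move=> w _; rewrite lee_fin ler_pM2l//.
      exact: (sp_truncate_energy _ _ HP).
  by rewrite integral_cst//= probability_setT mule1.
- move=> w AEw.
  have nA : ~ A w by move=> Aw; apply: AEw; left.
  rewrite -(sp_truncate_integral HP (Ac w nA)) ltNge; apply/negP => eM.
  apply: AEw; right; split => //; change ((e ^+ 2)%:E <= `|g w|)%E.
  rewrite gee0_abs ?lee_fin ?sqr_ge0//.
  rewrite -[M w ^+ 2]real_normK ?num_real//.
  by rewrite ler_pXn2r// ?nnegrE ?ltW.
Qed.

Lemma sp_integral_cvg0 a b (H_ : nat -> @simple_process R d Omega) :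
  0 <= a -> (forall n, simple_process_on F a b (H_ n)) ->
  cvg0_in_probability P (fun n w =>
    (\int[lebesgue_measure]_(t in `[a, b]) (sp_value (H_ n) t w ^+ 2)%:E)%E) ->
  cvg0_in_probability P (fun n w => (sp_integral B (H_ n) w)%:E).
Proof.
move=> a0 HP H0 e del e0 del0.
(* The level for which 8 c / e ^+ 2 is the second half of del. *)
pose c := del * e ^+ 2 / 16.
have e20 : 0 < e ^+ 2 by rewrite exprn_gt0.
have c0 : 0 < c by rewrite divr_gt0// mulr_gt0.
have del20 : 0 < del / 2 by rewrite divr_gt0.
apply: filterS (H0 c (del / 2) c0 del20) => n [A [mA PA Ac]].
have [|A' [mA' PA' A'e]] :=
    @sp_integral_small a b e c (H_ n) A a0 e0 (ltW c0) (HP n) mA.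
  move=> w nA; have := Ac w nA; rewrite (integral_sp_value_sqr w (HP n)).
  rewrite /= lte_fin => /ltW; apply: le_trans; exact: ler_norm.
exists A'; split => //.
- apply: le_trans PA' _.
  apply: (@le_trans _ _ ((del / 2)%:E + (8 * c / e ^+ 2)%:E)%E).
    by rewrite leeD2r.
  rewrite -EFinD lee_fin le_eqVlt; apply/orP; left; apply/eqP.
  by rewrite /c; field; rewrite gt_eqF.
Qed.

End ItoEstimate.

(** * Common refinements and concatenation of simple processes *)
Section Refinement.
Context (R : realType) (d : measure_display) (Omega : measurableType d).
Implicit Types (F : R -> set (set Omega)) (a b t : R).
Implicit Types (H K : @simple_process R d Omega).

Lemma grid_cell (g : nat -> R) N t : g 0%N < t -> t <= g N ->
  exists2 j, (j < N)%N & g j < t <= g j.+1.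
Proof.
elim: N => [|N IH] t0 tN; first by move: (lt_le_trans t0 tN); rewrite ltxx.
have [tN'|] := leP t (g N); last by exists N => //; apply/andP.
by have [j jN jt] := IH t0 tN'; exists j => //; exact: ltnW.
Qed.

Variables (g : nat -> R) (N : nat).
Hypothesis g_mono : forall i j, (i <= j)%N -> (j <= N)%N -> g i <= g j.

Lemma grid_lt k j : (k <= N)%N -> (j < N)%N -> g k < g j.+1 -> g k <= g j.
Proof.
move=> kN jN lt; apply: g_mono; last exact: ltnW.
rewrite leqNgt; apply/negP => jk.
by have := g_mono jk kN; rewrite leNgt lt.
Qed.

(** The sum telescopes after clipping to [g k, g l]: since both ends are on the
    grid, each step of the grid either lies inside or is clipped to a point. *)
Lemma sum_grid_increments (f : R -> R) k l : (k <= l)%N -> (l <= N)%N ->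
  \sum_(j < N) \1_(`]g k, g l]) (g j.+1) * (f (g j.+1) - f (g j)) =
  f (g l) - f (g k).
Proof.
move=> kl lN; pose clip x := Num.max (g k) (Num.min x (g l)).
have kl' : g k <= g l by exact: g_mono.
have E j : (j < N)%N ->
    \1_(`]g k, g l]) (g j.+1) * (f (g j.+1) - f (g j)) =
    f (clip (g j.+1)) - f (clip (g j)).
  move=> jN; have jj : g j <= g j.+1 by exact: g_mono.
  rewrite indicE; have [/set_mem/=|nin] := boolP (_ \in _).
    rewrite in_itv/= mul1r => /andP[kj jl].
    have kj' : g k <= g j by apply: grid_lt => //; exact: leq_trans kl lN.
    by rewrite /clip !min_l ?(le_trans jj)// !max_r// ltW.
  rewrite mul0r /clip.
  have [jk|kj] := leP (g j.+1) (g k).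
    rewrite !min_l ?(le_trans jj) ?(le_trans jk)// !max_l ?subrr//.
    exact: le_trans jj jk.
  have lj : g l < g j.+1.
    rewrite ltNge; apply: contra nin => jl; apply: mem_set => /=.
    by rewrite in_itv/= kj.
  have lj' : g l <= g j by exact: grid_lt.
  by rewrite !min_r ?subrr// ltW.
rewrite (eq_bigr (fun j : 'I_N => f (clip (g j.+1)) - f (clip (g j))));
  last by move=> j _; exact: E.
rewrite -(big_mkord xpredT (fun j => f (clip (g j.+1)) - f (clip (g j)))).
rewrite telescope_sumr// /clip; congr (f _ - f _).
  by rewrite min_r ?g_mono// max_r.
have gk : g 0%N <= g k by apply: g_mono => //; exact: leq_trans kl lN.
by rewrite min_l ?max_l// (le_trans gk).
Qed.

Definition on_grid H := forall i, (i <= sp_size H)%N ->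
  exists2 k, (k <= N)%N & sp_time H i = g k.

(** Simple processes are left-continuous, so that the value on a cell of the
    grid is the value at its right end. *)
Definition sp_refine H : @simple_process R d Omega :=
  SimpleProcess N g (fun j w => sp_value H (g j.+1) w).

(** A partition point of H that lies before g j.+1 lies at or before g j; hence
    the value of H at the right end of a cell is known at its left end. *)
Lemma sp_refine_coef F H j : on_grid H -> simple_process_on F (g 0%N) (g N) H ->
  (j < N)%N ->
  (exists i, [/\ (i < sp_size H)%N, sp_time H i <= g j, g j.+1 <= sp_time H i.+1
     & sp_value H (g j.+1) = sp_coef H i]) \/ sp_value H (g j.+1) = cst 0.
Proof.
move=> oH HP jN; have [H0 HN _ _ _] := HP.
have gj : g j.+1 <= sp_time H (sp_size H) by rewrite HN g_mono.
have [lt|ge] := ltP (sp_time H 0%N) (g j.+1); last first.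
  right; apply/funext => w; apply: sp_value_outside HP _.
  by rewrite -[X in _ <= X]H0 ge.
have [i ni /andP[it ti]] := grid_cell lt gj.
left; exists i; split => //.
  by have [k kN E] := oH i (ltnW ni); move: it; rewrite E; exact: grid_lt.
by apply/funext => w; apply: sp_valueE HP ni _; rewrite it.
Qed.

Context (B : R -> Omega -> R) (X0 : Omega -> R).
Local Notation F := (filtration X0 B).

Lemma sp_refine_on H : on_grid H -> simple_process_on F (g 0%N) (g N) H ->
  simple_process_on F (g 0%N) (g N) (sp_refine H).
Proof.
move=> oH HP; have [_ _ _ mh bh] := HP; split => //= j jN.
- exact: g_mono.
- have [[i [ni ij _ ->]]|->] := sp_refine_coef oH HP jN.
    exact: measurable_wrt_le ij (mh i ni).
  by apply/measurable_wrtP; exact: measurable_cst.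
- have [[i [ni ij _ ->]]|->] := sp_refine_coef oH HP jN; first exact: bh.
  by exists 0 => w; rewrite normr0.
Qed.

Lemma sp_refine_value H t w : on_grid H ->
  simple_process_on F (g 0%N) (g N) H ->
  sp_value (sp_refine H) t w = sp_value H t w.
Proof.
move=> oH HP; have HP' := sp_refine_on oH HP.
have [out|] := boolP ((t <= g 0%N) || (g N < t)).
  by rewrite (sp_value_outside w HP out) (sp_value_outside w HP' out).
rewrite negb_or -ltNge -leNgt => /andP[t0 tN].
have [j jN jt] := grid_cell t0 tN.
rewrite (sp_valueE w HP' jN jt)/=; case/andP: jt => jt tj.
have [[i [ni ij ji ->]]|E] := sp_refine_coef oH HP jN.
  by rewrite (sp_valueE w HP ni)// (le_lt_trans ij jt) (le_trans tj ji).
have [H0 HN _ _ _] := HP.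
have [||i ni /andP[it ti]] := @grid_cell (sp_time H) (sp_size H) t.
- by rewrite H0.
- by rewrite HN.
have [k kN Ek] := oH i.+1 ni.
rewrite E (sp_valueE w HP ni) ?it//= -(sp_valueE w HP ni (t := g j.+1)) ?E//.
rewrite (lt_le_trans it tj)/= Ek; apply: g_mono => //.
rewrite ltnNge; apply/negP => /g_mono-/(_ (ltnW jN)).
by rewrite leNgt -Ek (lt_le_trans jt ti).
Qed.

Lemma sp_refine_integral H w : on_grid H ->
  simple_process_on F (g 0%N) (g N) H ->
  sp_integral B (sp_refine H) w = sp_integral B H w.
Proof.
move=> oH HP; rewrite /sp_integral /= /sp_value.
under eq_bigr do rewrite mulr_suml.
rewrite exchange_big/=; apply: eq_bigr => i _.
under eq_bigr do rewrite -mulrA.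
rewrite -mulr_sumr; congr (_ * _).
have ni := ltn_ord i.
have [k kN Ek] := oH i (ltnW ni); have [l lN El] := oH i.+1 ni.
rewrite Ek El; have [kl|lk] := leqP k l.
  by rewrite (sum_grid_increments (fun x => B x w) kl lN).
have Ekl : g k = g l.
  apply/eqP; rewrite eq_le (g_mono (ltnW lk) kN) andbT -Ek -El.
  by case: HP => _ _ + _ _; apply.
rewrite Ekl subrr big1// => j _; rewrite indicE memNset ?mul0r//=.
by rewrite in_itv/= => /andP[/lt_le_trans/[apply]]; rewrite ltxx.
Qed.

Definition sp_combine (c : R) H (e : R) K : @simple_process R d Omega :=
  SimpleProcess N g
    (fun j w => c * sp_value H (g j.+1) w + e * sp_value K (g j.+1) w).

Lemma sp_combine_on c H e K :
  on_grid H -> simple_process_on F (g 0%N) (g N) H ->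
  on_grid K -> simple_process_on F (g 0%N) (g N) K ->
  simple_process_on F (g 0%N) (g N) (sp_combine c H e K).
Proof.
move=> oH HP oK KP.
have [_ _ _ mh bh] := sp_refine_on oH HP.
have [_ _ _ mk bk] := sp_refine_on oK KP.
split => //= j jN.
- exact: g_mono.
- have /measurable_wrtP mh' := mh j jN; have /measurable_wrtP mk' := mk j jN.
  apply/measurable_wrtP; apply: measurable_funD; exact: measurable_funM.
- have [C hC] := bh j jN; have [D hD] := bk j jN.
  exists (`|c| * C + `|e| * D) => w; apply: le_trans (ler_normD _ _) _.
  by rewrite !normrM lerD// ler_wpM2l//; [exact: hC|exact: hD].
Qed.

Lemma sp_combine_value c H e K t w :
  on_grid H -> simple_process_on F (g 0%N) (g N) H ->
  on_grid K -> simple_process_on F (g 0%N) (g N) K ->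
  sp_value (sp_combine c H e K) t w = c * sp_value H t w + e * sp_value K t w.
Proof.
move=> oH HP oK KP.
rewrite -(sp_refine_value t w oH HP) -(sp_refine_value t w oK KP).
rewrite /sp_value/= !mulr_sumr -big_split/=; apply: eq_bigr => j _.
by rewrite mulrDl !mulrA.
Qed.

Lemma sp_combine_integral c H e K w :
  on_grid H -> simple_process_on F (g 0%N) (g N) H ->
  on_grid K -> simple_process_on F (g 0%N) (g N) K ->
  sp_integral B (sp_combine c H e K) w =
  c * sp_integral B H w + e * sp_integral B K w.
Proof.
move=> oH HP oK KP.
rewrite -(sp_refine_integral w oH HP) -(sp_refine_integral w oK KP).
rewrite /sp_integral/= !mulr_sumr -big_split/=; apply: eq_bigr => j _.
by rewrite mulrDl !mulrA.
Qed.

End Refinement.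

Section SimpleProcessOperations.
Context (R : realType) (d : measure_display) (Omega : measurableType d).
Context (B : R -> Omega -> R) (X0 : Omega -> R).
Local Notation F := (filtration X0 B).
Implicit Types (a b t : R) (H K : @simple_process R d Omega).

Lemma common_grid a b H K :
  simple_process_on F a b H -> simple_process_on F a b K ->
  exists g N, [/\ forall i j, (i <= j)%N -> (j <= N)%N -> g i <= g j,
    g 0%N = a, g N = b, on_grid g N H & on_grid g N K].
Proof.
move=> HP KP.
pose r := mkseq (sp_time H) (sp_size H).+1 ++ mkseq (sp_time K) (sp_size K).+1.
pose s := sort <=%R r; pose N := (size s).-1.
have sN : size s = N.+1 by rewrite /N /s size_sort size_cat !size_mkseq.
have ss : sorted <=%R s by apply: sort_sorted; exact: le_total.
pose g := nth b s.
have gm i j : (i <= j)%N -> (j <= N)%N -> g i <= g j.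
  move=> ij jN; apply: (sorted_leq_nth le_trans le_refl b ss) => //;
    by rewrite inE sN ltnS// (leq_trans ij).
have gP x : x \in r -> exists2 k, (k <= N)%N & x = g k.
  rewrite -(mem_sort <=%R) -/s => /(nthP b)[k]; rewrite sN ltnS => kN <-.
  by exists k.
have oH : on_grid g N H.
  move=> i ni; apply: gP; rewrite mem_cat; apply/orP; left.
  by apply/mapP; exists i => //; rewrite mem_iota.
have oK : on_grid g N K.
  move=> i ni; apply: gP; rewrite mem_cat; apply/orP; right.
  by apply/mapP; exists i => //; rewrite mem_iota.
have rab x : x \in r -> a <= x <= b.
  rewrite mem_cat => /orP[] /mapP[i]; rewrite mem_iota/= add0n ltnS => ni ->.
    by rewrite (sp_time_ge HP ni) (sp_time_le HP ni).
  by rewrite (sp_time_ge KP ni) (sp_time_le KP ni).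
have gab k : (k <= N)%N -> a <= g k <= b.
  move=> kN; apply: rab; rewrite -(mem_sort <=%R) mem_nth// sN ltnS//.
have [Ha Hb _ _ _] := HP.
exists g, N; split => //.
- have [k kN E] := oH 0%N (leq0n _); apply/eqP; rewrite eq_le.
  have /andP[-> _] := gab 0%N (leq0n _); rewrite andbT -[leRHS]Ha E.
  exact: gm.
- have [k kN E] := oH _ (leqnn _); apply/eqP; rewrite eq_le.
  have /andP[_ ->] := gab N (leqnn _); rewrite /= -[leLHS]Hb E.
  exact: gm.
Qed.

Lemma sp_linear_combination a b c H e K :
  simple_process_on F a b H -> simple_process_on F a b K ->
  exists L, [/\ simple_process_on F a b L,
    forall t w, sp_value L t w = c * sp_value H t w + e * sp_value K t w &
    forall w, sp_integral B L w =
      c * sp_integral B H w + e * sp_integral B K w].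
Proof.
move=> HP KP; have [g [N [gm g0 gN oH oK]]] := common_grid HP KP.
rewrite -{}g0 -{}gN in HP KP *; exists (sp_combine g N c H e K); split.
- exact: sp_combine_on.
- by move=> t w; exact: (sp_combine_value gm _ _ _ _ oH HP oK KP).
- by move=> w; exact: (sp_combine_integral gm _ _ _ oH HP oK KP).
Qed.

Definition sp_cat H K : @simple_process R d Omega :=
  SimpleProcess (sp_size H + sp_size K)
    (fun i => if (i <= sp_size H)%N then sp_time H i
              else sp_time K (i - sp_size H))
    (fun i => if (i < sp_size H)%N then sp_coef H i
              else sp_coef K (i - sp_size H)).

Section Cat.
Variables (a b c : R) (H K : @simple_process R d Omega).
Hypotheses (HP : simple_process_on F a b H) (KP : simple_process_on F b c K).

Let timeD j : sp_time (sp_cat H K) (sp_size H + j) = sp_time K j.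
Proof.
rewrite /=; case: j => [|j].
  by rewrite addn0 leqnn; case: HP => _ -> _ _ _; case: KP.
by rewrite leqNgt addnS ltnS leq_addr/= -addnS addKn.
Qed.

Let coefD j : sp_coef (sp_cat H K) (sp_size H + j) = sp_coef K j.
Proof. by rewrite /= ltnNge leq_addr/= addKn. Qed.

Lemma sp_cat_on : simple_process_on F a c (sp_cat H K).
Proof.
have [Ha Hb monoH mH bH] := HP; have [Kb Kc monoK mK bK] := KP.
have cases i : (i < sp_size H + sp_size K)%N ->
   (i < sp_size H)%N \/ exists2 j, (j < sp_size K)%N & i = (sp_size H + j)%N.
  move=> ni; have [lt|ge] := ltnP i (sp_size H); first by left.
  by right; exists (i - sp_size H)%N; rewrite ?subnKC// ltn_subLR.
split => //.
- by rewrite -[sp_size _]/(sp_size H + sp_size K)%N timeD.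
- move=> i /cases[ni|[j nj ->]].
    by rewrite /= (ltnW ni) ni monoH.
  by rewrite -addnS !timeD monoK.
- move=> i /cases[ni|[j nj ->]].
    by rewrite /= (ltnW ni) ni; exact: mH.
  by rewrite !timeD coefD; exact: mK.
- move=> i /cases[ni|[j nj ->]].
    by rewrite /= ni; exact: bH.
  by rewrite coefD; exact: bK.
Qed.

Lemma sp_cat_sum (f : R -> R -> R) w :
  \sum_(i < sp_size (sp_cat H K)) sp_coef (sp_cat H K) i w *
     f (sp_time (sp_cat H K) i) (sp_time (sp_cat H K) i.+1) =
  \sum_(i < sp_size H) sp_coef H i w * f (sp_time H i) (sp_time H i.+1) +
  \sum_(i < sp_size K) sp_coef K i w * f (sp_time K i) (sp_time K i.+1).
Proof.
rewrite [LHS]big_split_ord; congr (_ + _); apply: eq_bigr => i _.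
  by rewrite /= (ltn_ord i) (ltnW (ltn_ord i)).
by rewrite [nat_of_ord _]/= -addnS !timeD coefD.
Qed.

Lemma sp_cat_value t w :
  sp_value (sp_cat H K) t w = sp_value H t w + sp_value K t w.
Proof. exact: (sp_cat_sum (fun x y => \1_(`]x, y]) t)). Qed.

Lemma sp_cat_integral w :
  sp_integral B (sp_cat H K) w = sp_integral B H w + sp_integral B K w.
Proof. exact: (sp_cat_sum (fun x y => B y w - B x w)). Qed.

End Cat.
End SimpleProcessOperations.

(** * Linearity, additivity and uniqueness of the Ito integral *)
Section ConvergenceInProbability.
Context (R : realType) (d : measure_display) (Omega : measurableType d).
Context (P : probability Omega R).

(** Every passage to the limit below is of this form: the two error terms of an
    Ito integral are dominated by those of two other ones. *)
Lemma cvg0_in_probability_le (k : R) (N : set Omega)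
    (Z U V : nat -> Omega -> \bar R) : 0 < k -> P.-negligible N ->
  (forall n w, ~ N w -> (`|Z n w| <= k%:E * (`|U n w| + `|V n w|))%E) ->
  cvg0_in_probability P U -> cvg0_in_probability P V ->
  cvg0_in_probability P Z.
Proof.
move=> k0 [N' [mN' PN' NN']] le cU cV e del e0 del0.
have e20 : 0 < e / (2 * k) by rewrite divr_gt0// mulr_gt0.
have del20 : 0 < del / 2 by rewrite divr_gt0.
apply: filterS2 (cU _ _ e20 del20) (cV _ _ e20 del20) =>
  n [A [mA PA Ae]] [C [mC PC Ce]].
exists (A `|` C `|` N'); split.
- by apply: measurableU => //; exact: measurableU.
- apply: le_trans (measureU2 _ (measurableU _ _ mA mC) mN') _.
  apply: (@le_trans _ _ (P (A `|` C) + 0)%E).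
    by apply: leeD2l; rewrite le_eqVlt; apply/orP; left; apply/eqP; exact: PN'.
  rewrite adde0; apply: le_trans (measureU2 _ mA mC) _.
  by rewrite [del]splitr EFinD leeD.
- move=> w nw; have nN : ~ N w by move=> /NN' ?; apply: nw; right.
  apply: le_lt_trans (le n w nN) _.
  have Aw : (`|U n w| < (e / (2 * k))%:E)%E.
    by apply: Ae => ?; apply: nw; left; left.
  have Cw : (`|V n w| < (e / (2 * k))%:E)%E.
    by apply: Ce => ?; apply: nw; left; right.
  have -> : e%:E = (k%:E * ((e / (2 * k))%:E + (e / (2 * k))%:E))%E.
    by rewrite -EFinD -EFinM; congr EFin; field; rewrite gt_eqF.
  by rewrite lte_pmul2l// lteD.
Qed.

Lemma cvg0_in_probability0 : cvg0_in_probability P (fun _ _ => 0%E).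
Proof.
move=> e del e0 del0; apply: nearW => n; exists set0; split => //.
  by rewrite measure0 lee_fin ltW.
by move=> w _; rewrite abse0 lte_fin.
Qed.

Lemma measurable_norm_ge (I : Omega -> R) (e : R) : measurable_fun setT I ->
  measurable [set w | e <= `|I w|].
Proof.
move=> mI; rewrite -[X in measurable X]setTI.
have mI' : measurable_fun setT (fun w => `|I w|) by exact: measurableT_comp.
have := mI' measurableT `[e, +oo[%classic (measurable_itv _).
by congr (measurable (_ `&` _)); apply/seteqP; split => w /=;
  rewrite in_itv/= andbT.
Qed.

Lemma cvg0_in_probability_cst (I : Omega -> R) : measurable_fun setT I ->
  cvg0_in_probability P (fun _ w => (I w)%:E) -> {ae P, forall w, I w = 0}.
Proof.
move=> mI cI.
have E0 (e : R) : 0 < e -> P [set w | e <= `|I w|] = 0%E.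
  move=> e0; have mE := measurable_norm_ge e mI.
  apply/eqP; rewrite eq_le measure_ge0 andbT; apply/lee_addgt0Pr => del del0.
  rewrite add0e; near \oo => n.
  have [A [mA PA Ae]] : exists A : set Omega, [/\ measurable A,
      (P A <= del%:E)%E & forall w, ~ A w -> (`|(I w)%:E| < e%:E)%E].
    by near: n; exact: cI.
  apply: le_trans PA; apply: le_measure; rewrite ?inE// => w /= eI.
  by apply: contrapT => /Ae; rewrite lte_fin ltNge eI.
have : {ae P, forall w (n : nat), `|I w| < n.+1%:R^-1}.
  apply/ae_foralln => n.
  exists [set w | n.+1%:R^-1 <= `|I w|]; split.
  - exact: measurable_norm_ge.
  - by apply: E0; rewrite invr_gt0.
  - by move=> w /= /negP; rewrite -leNgt.
apply: filterS => w le; apply/eqP; rewrite -normr_eq0 eq_le normr_ge0 andbT.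
rewrite leNgt; apply/negP => I0.
have [n] := ltr_add_invr I0; rewrite add0r => /ltW; rewrite leNgt.
by rewrite (le n).
Unshelve. all: by end_near. Qed.

End ConvergenceInProbability.

Section SquareIntegrals.
Context (R : realType).
Local Notation mu := lebesgue_measure.

Lemma ge0_integral_sqr_comb (D : set R) (x y : R) (f g : R -> R) :
  measurable D -> measurable_fun D f -> measurable_fun D g ->
  (\int[mu]_(t in D) ((x * f t + y * g t) ^+ 2)%:E <=
   (2 * x ^+ 2 + 2 * y ^+ 2 + 1)%:E *
   (\int[mu]_(t in D) (f t ^+ 2)%:E + \int[mu]_(t in D) (g t ^+ 2)%:E))%E.
Proof.
move=> mD mf mg.
have f0 t : (0 <= (f t ^+ 2)%:E)%E by rewrite lee_fin sqr_ge0.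
have g0 t : (0 <= (g t ^+ 2)%:E)%E by rewrite lee_fin sqr_ge0.
have mf2 : measurable_fun D (fun t => (f t ^+ 2)%:E).
  exact/measurable_EFinP/measurable_funX.
have mg2 : measurable_fun D (fun t => (g t ^+ 2)%:E).
  exact/measurable_EFinP/measurable_funX.
set k := 2 * x ^+ 2 + 2 * y ^+ 2 + 1.
have k0 : 0 <= k by rewrite !addr_ge0// pmulr_rge0// sqr_ge0.
rewrite -ge0_integralD// -ge0_integralZl//; first last.
- by move=> t _; rewrite adde_ge0.
- exact: emeasurable_funD.
apply: ge0_le_integral => //.
- by move=> t _; rewrite lee_fin sqr_ge0.
- apply/measurable_EFinP/measurable_funX/measurable_funD;
    exact: measurable_funM.
- by apply: emeasurable_funM => //; exact: emeasurable_funD.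
- move=> t _; rewrite -EFinD -EFinM lee_fin /k.
  move: (f t) (g t) => u v.
  rewrite -subr_ge0.
  have -> : (2 * x ^+ 2 + 2 * y ^+ 2 + 1) * (u ^+ 2 + v ^+ 2)
      - (x * u + y * v) ^+ 2 =
    (x * u - y * v) ^+ 2 + 2 * (x * v) ^+ 2 + 2 * (y * u) ^+ 2
      + u ^+ 2 + v ^+ 2 by ring.
  by rewrite !addr_ge0// ?sqr_ge0// pmulr_rge0// sqr_ge0.
Qed.

End SquareIntegrals.

Section ItoIntegral.
Context (R : realType) (d : measure_display) (Omega : measurableType d).
Context (P : probability Omega R) (B : R -> Omega -> R) (X0 : Omega -> R).
Hypothesis BM : standard_brownian_motion P B.
Hypothesis mX0 : measurable_fun setT X0.
Hypothesis ind0 : independent_sigma P (preimage_set_system setT X0 measurable)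
    (sigma_of `[0%R, +oo[ B).
Local Notation F := (filtration X0 B).
Local Notation mu := lebesgue_measure.
Local Notation ito := (is_ito_integral P F B).
Implicit Types (a b t : R) (H K : R -> Omega -> R).

(** What makes the Lebesgue integral of a squared error subadditive. *)
Definition ae_measurable_paths a b H : Prop :=
  {ae P, forall w, measurable_fun `[a, b] (fun t => H t w)}.

Lemma ae_measurable_paths_comb a b x y H K :
  ae_measurable_paths a b H -> ae_measurable_paths a b K ->
  ae_measurable_paths a b (fun t w => x * H t w + y * K t w).
Proof.
apply: filterS2 => w mH mK; apply: measurable_funD; exact: measurable_funM.
Qed.

(** The approximations of H and K live on different partitions and are combined
    on a common refinement. *)
Lemma ito_integral_comb a b x y H K (I J : Omega -> R) :
  ae_measurable_paths a b H -> ae_measurable_paths a b K ->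
  ito a b H I -> ito a b K J ->
  ito a b (fun t w => x * H t w + y * K t w) (fun w => x * I w + y * J w).
Proof.
move=> [NH [mNH PNH HN]] [NK [mNK PNK KN]].
move=> [mI [H_ [HP HL2 HI]]] [mJ [K_ [KP KL2 KJ]]].
split; first by apply: measurable_funD; exact: measurable_funM.
have /choice[L_ LP] := fun n => sp_linear_combination x y (HP n) (KP n).
exists L_; split.
- by move=> n; have [] := LP n.
- have nN : P.-negligible (NH `|` NK).
    by apply: negligibleU; [exists NH; split|exists NK; split].
  have k0 : 0 < 2 * x ^+ 2 + 2 * y ^+ 2 + 1.
    by rewrite ltr_wpDl// addr_ge0// pmulr_rge0// sqr_ge0.
  apply: cvg0_in_probability_le k0 nN _ HL2 KL2 => n w nw.
  have mHw : measurable_fun `[a, b] (fun t => H t w).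
    by apply: contrapT => h; apply: nw; left; exact: HN.
  have mKw : measurable_fun `[a, b] (fun t => K t w).
    by apply: contrapT => h; apply: nw; right; exact: KN.
  rewrite !gee0_abs;
    [|by apply: integral_ge0 => t _; rewrite lee_fin sqr_ge0..].
  have [_ vL _] := LP n.
  have -> : (\int[mu]_(t in `[a, b])
        ((sp_value (L_ n) t w - (x * H t w + y * K t w)) ^+ 2)%:E =
      \int[mu]_(t in `[a, b]) ((x * (sp_value (H_ n) t w - H t w) +
        y * (sp_value (K_ n) t w - K t w)) ^+ 2)%:E)%E.
    by apply: eq_integral => t _; rewrite vL; congr ((_ ^+ 2)%:E); ring.
  apply: ge0_integral_sqr_comb => //; apply: measurable_funB => //;
    exact: measurable_sp_value.
- have k0 : 0 < `|x| + `|y| + 1 by rewrite ltr_wpDl// addr_ge0.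
  apply: cvg0_in_probability_le k0 (negligible_set0 _) _ HI KJ => n w _.
  have [_ _ ->] := LP n.
  rewrite -!EFinD -EFinM lee_fin.
  set u := sp_integral B (H_ n) w; set v := sp_integral B (K_ n) w.
  have -> : x * u + y * v - (x * I w + y * J w) =
    x * (u - I w) + y * (v - J w) by ring.
  apply: le_trans (ler_normD _ _) _; rewrite !normrM.
  have := normr_ge0 (u - I w); have := normr_ge0 (v - J w).
  have := normr_ge0 x; have := normr_ge0 y.
  by nra.
Qed.

Lemma ito_integral_cst0 a b : a <= b -> ito a b (fun _ _ => 0) (fun _ => 0).
Proof.
move=> ab; split=> //.
pose Z : @simple_process R d Omega :=
  SimpleProcess 1 (fun i => if i == 0%N then a else b) (fun _ _ => 0).
have Zv t w : sp_value Z t w = 0.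
  by rewrite /sp_value big1// => i _; rewrite mul0r.
exists (fun=> Z); split.
- move=> _; split => //= -[|i]//= _.
    by apply/measurable_wrtP; exact: measurable_cst.
  by exists 0 => w; rewrite normr0.
- rewrite (_ : (fun _ _ => _) = (fun _ _ => 0%E)); last first.
    apply/funext => n; apply/funext => w.
    by rewrite integral0_eq// => t _; rewrite Zv subr0 expr0n.
  exact: cvg0_in_probability0.
- have -> : (fun (n : nat) w => (sp_integral B Z w - 0)%:E) = (fun _ _ => 0%E).
    apply/funext => n; apply/funext => w; rewrite /sp_integral big1 ?subr0//.
    by move=> i _; rewrite mul0r.
  exact: cvg0_in_probability0.
Qed.

(** The simple processes that approximate 0 have energies tending to 0 in
    probability, and so have their integrals. *)
Lemma ito_integral_of0 a b I : 0 <= a ->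
  ito a b (fun _ _ => 0) I -> {ae P, forall w, I w = 0}.
Proof.
move=> a0 [mI [H_ [HP HL2 HI]]]; apply: cvg0_in_probability_cst => //.
have HL2' : cvg0_in_probability P (fun n w =>
    (\int[mu]_(t in `[a, b]) (sp_value (H_ n) t w ^+ 2)%:E)%E).
  move: HL2; congr cvg0_in_probability.
  apply/funext => n; apply/funext => w; apply: eq_integral => t _.
  by rewrite subr0.
have cH := sp_integral_cvg0 BM mX0 ind0 a0 HP HL2'.
apply: cvg0_in_probability_le ltr01 (negligible_set0 _) _ cH HI => n w _.
rewrite mul1e -EFinD lee_fin.
set u := sp_integral B (H_ n) w; have -> : I w = u - (u - I w) by ring.
apply: le_trans (ler_normB _ _) _; by rewrite subKr.
Qed.

Lemma ito_integral_unique a b H I J : 0 <= a -> ae_measurable_paths a b H ->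
  ito a b H I -> ito a b H J -> {ae P, forall w, I w = J w}.
Proof.
move=> a0 mH HI HJ; have := ito_integral_comb 1 (-1) mH mH HI HJ.
rewrite (_ : (fun t w => _) = (fun _ _ => 0)); last first.
  by apply/funext => t; apply/funext => w; rewrite mul1r mulN1r subrr.
move/(ito_integral_of0 a0); apply: filterS => w.
by rewrite mul1r mulN1r => /eqP; rewrite subr_eq0 => /eqP.
Qed.

(** Each simple process vanishes outside its own interval, so that the squared
    errors of the two approximations add up. *)
Lemma ito_integral_cat a b c H (I J : Omega -> R) : a <= b -> b <= c ->
  ae_measurable_paths a c H ->
  ito a b H I -> ito b c H J -> ito a c H (fun w => I w + J w).
Proof.
move=> ab bc [NH [mNH PNH HN]].
move=> [mI [H_ [HP HL2 HI]]] [mJ [K_ [KP KL2 KJ]]].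
split; first exact: measurable_funD.
exists (fun n => sp_cat (H_ n) (K_ n)); split.
- by move=> n; exact: sp_cat_on.
- have nN : P.-negligible NH by exists NH; split.
  apply: cvg0_in_probability_le ltr01 nN _ HL2 KL2 => n w nw.
  have mHw : measurable_fun `[a, c] (fun t => H t w).
    by apply: contrapT => h; apply: nw; exact: HN.
  rewrite !gee0_abs;
    [|by apply: integral_ge0 => t _; rewrite lee_fin sqr_ge0..].
  rewrite mul1e.
  pose f t := ((sp_value (sp_cat (H_ n) (K_ n)) t w - H t w) ^+ 2)%:E.
  have mf : measurable_fun `[a, c] f.
    apply/measurable_EFinP/measurable_funX/measurable_funB => //.
    exact: measurable_sp_value.
  have mg : measurable_fun `[b, c]
      (fun t => ((sp_value (K_ n) t w - H t w) ^+ 2)%:E).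
    apply/measurable_EFinP/measurable_funX/measurable_funB => //.
      exact: measurable_sp_value.
    apply: measurable_funS mHw => // t /=; rewrite !in_itv/= => /andP[bt ->].
    by rewrite (le_trans ab).
  have acE : `[a, c]%classic = `[a, b]%classic `|` `]b, c]%classic.
    by rewrite -itv_bndbnd_setU// bnd_simp.
  rewrite acE ge0_integral_setU//; first last.
  - apply: lt_disjoint => x y /=.
    by rewrite !in_itv/= => /andP[_ xb] /andP[/(le_lt_trans xb)].
  - by move=> t _; rewrite lee_fin sqr_ge0.
  - by rewrite -acE.
  apply: leeD.
    rewrite le_eqVlt; apply/orP; left; apply/eqP; apply: eq_integral => t.
    rewrite inE/= in_itv/= => /andP[_ tb]; rewrite (sp_cat_value (HP n) (KP n)).
    by rewrite (sp_value_outside w (KP n)) ?addr0// tb.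
  apply: le_trans (_ : (\int[mu]_(t in `]b, c])
      ((sp_value (K_ n) t w - H t w) ^+ 2)%:E <= _)%E).
    rewrite le_eqVlt; apply/orP; left; apply/eqP; apply: eq_integral => t.
    rewrite inE/= in_itv/= => /andP[bt _]; rewrite (sp_cat_value (HP n) (KP n)).
    by rewrite (sp_value_outside w (HP n)) ?add0r// bt orbT.
  apply: ge0_subset_integral => //.
    by move=> t _; rewrite lee_fin sqr_ge0.
  by move=> t /=; rewrite !in_itv/= => /andP[/ltW-> ->].
- apply: cvg0_in_probability_le ltr01 (negligible_set0 _) _ HI KJ => n w _.
  rewrite mul1e -!EFinD lee_fin (sp_cat_integral (HP n) (KP n)).
  by rewrite opprD addrACA ler_normD.
Qed.

Lemma ae_measurable_paths_sum (n : nat) a b (c : 'I_n -> R)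
    (H : 'I_n -> R -> Omega -> R) :
  (forall i, ae_measurable_paths a b (H i)) ->
  ae_measurable_paths a b (fun t w => \sum_(i < n) c i * H i t w).
Proof.
elim: n => [|n IH] in c H * => mH.
  under eq_fun do under eq_fun do rewrite big_ord0.
  exact/aeW.
under eq_fun do under eq_fun do rewrite big_ord_recr/= -[X in X + _]mul1r.
by apply: ae_measurable_paths_comb => //; exact: IH.
Qed.

Lemma ito_integral_sum (n : nat) a b (c : 'I_n -> R)
    (H : 'I_n -> R -> Omega -> R) (I : 'I_n -> Omega -> R) : a <= b ->
  (forall i, ae_measurable_paths a b (H i)) ->
  (forall i, ito a b (H i) (I i)) ->
  ito a b (fun t w => \sum_(i < n) c i * H i t w)
    (fun w => \sum_(i < n) c i * I i w).
Proof.
move=> ab; elim: n => [|n IH] in c H I * => mH HI.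
  under eq_fun do under eq_fun do rewrite big_ord0.
  under [X in is_ito_integral _ _ _ _ _ _ X]eq_fun do rewrite big_ord0.
  exact: ito_integral_cst0.
under eq_fun do under eq_fun do rewrite big_ord_recr/= -[X in X + _]mul1r.
under [X in is_ito_integral _ _ _ _ _ _ X]eq_fun do
  rewrite big_ord_recr/= -[X in X + _]mul1r.
apply: ito_integral_comb => //; last by apply: IH.
exact: ae_measurable_paths_sum.
Qed.

End ItoIntegral.

(** * Maximization of a quadratic log-likelihood *)
Section QuadraticLogLikelihood.
Context (R : realType).

Definition dot n (u v : 'cV[R]_n) : R := (u^T *m v) ord0 ord0.

Section Dot.
Context (n : nat).
Implicit Types (u v w : 'cV[R]_n) (A : 'M[R]_n).

Lemma dotC u v : dot u v = dot v u.
Proof.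
have E : (u^T *m v)^T = v^T *m u by rewrite trmx_mul trmxK.
by rewrite /dot -E [RHS]mxE.
Qed.

Lemma dotDl u v w : dot (u + v) w = dot u w + dot v w.
Proof. by rewrite /dot raddfD/= mulmxDl mxE. Qed.

Lemma dotZl k u v : dot (k *: u) v = k * dot u v.
Proof. by rewrite /dot linearZ/= -scalemxAl mxE. Qed.

Lemma dotDr u v w : dot u (v + w) = dot u v + dot u w.
Proof. by rewrite dotC dotDl !(dotC u). Qed.

Lemma dotZr k u v : dot u (k *: v) = k * dot u v.
Proof. by rewrite dotC dotZl dotC. Qed.

Lemma dotNl u v : dot (- u) v = - dot u v.
Proof. by rewrite -scaleN1r dotZl mulN1r. Qed.

Lemma dotNr u v : dot u (- v) = - dot u v.
Proof. by rewrite dotC dotNl dotC. Qed.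

Lemma dot_mul_sym A u v : A^T = A -> dot (A *m u) v = dot u (A *m v).
Proof. by move=> sA; rewrite /dot trmx_mul sA mulmxA. Qed.

Lemma dotE u v : dot u v = \sum_i u i ord0 * v i ord0.
Proof. by rewrite /dot mxE; apply: eq_bigr => i _; rewrite mxE. Qed.

Lemma dot_eq0 u : dot u u = 0 -> u = 0.
Proof.
rewrite dotE => /eqP; rewrite psumr_eq0; last first.
  by move=> i _; rewrite -expr2 sqr_ge0.
move/allP => u0; apply/matrixP => i j; rewrite (ord1 j) mxE.
have := u0 i; rewrite mem_index_enum => /(_ isT).
by rewrite mulf_eq0 orbb => /eqP.
Qed.

Lemma dot_ge0 u : 0 <= dot u u.
Proof. by rewrite dotE sumr_ge0// => i _; rewrite -expr2 sqr_ge0. Qed.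

Definition quad A (c u : 'cV[R]_n) : R := 2 * dot c u - dot u (A *m u).

Lemma quad_line A c u v t : A^T = A ->
  quad A c (u + t *: v) =
  quad A c u + 2 * t * dot v (c - A *m u) - t ^+ 2 * dot v (A *m v).
Proof.
move=> sA; rewrite /quad mulmxDr -scalemxAr.
rewrite !(dotDl, dotDr, dotZl, dotZr, dotNr).
by rewrite (dotC v c) -(dot_mul_sym u v sA) (dotC (A *m u) v); ring.
Qed.

(** Along v = c - A u the slope is 2 |v|^2; were it positive, it would dominate
    the quadratic term for small t. *)
Lemma quad_local_max A c u : A^T = A ->
  (forall v, exists2 e, 0 < e & forall t, 0 <= t <= e ->
     quad A c (u + t *: v) <= quad A c u) ->
  A *m u = c.
Proof.
move=> sA umax; apply/esym/eqP; rewrite -subr_eq0; apply/eqP.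
set v := c - A *m u; apply: dot_eq0; apply/eqP.
rewrite eq_le dot_ge0 andbT leNgt; apply/negP => L0.
have [e e0 le] := umax v.
pose m := `|dot v (A *m v)| + 1.
have m0 : 0 < m by rewrite ltr_wpDl.
pose t := Num.min e (dot v v / m).
have t0 : 0 < t by rewrite lt_min e0 divr_gt0.
have te : t <= e by rewrite ge_min lexx.
have tm : t * m <= dot v v by rewrite -ler_pdivlMr// ge_min lexx orbT.
have := le t; rewrite (ltW t0) te => /(_ isT).
rewrite quad_line// -/v.
have Mm : dot v (A *m v) <= m.
  by apply: le_trans (ler_norm _) _; rewrite lerDl.
have : t ^+ 2 * dot v (A *m v) <= t * dot v v.
  rewrite expr2 -mulrA ler_pM2l//; apply: le_trans tm.
  by rewrite ler_pM2l.
have : 0 < t * dot v v by rewrite mulr_gt0.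
by lra.
Qed.

Lemma quad_critical A c u : A^T = A -> A \in unitmx -> A *m u = c ->
  quad A c u = dot c (invmx A *m c).
Proof. by move=> sA uA <-; rewrite /quad mulKmx// (dotC u); ring. Qed.

(** Only the last term is not additive in (A, r); the other two cancel in the
    likelihood ratio. *)
Lemma dot_shift A u k r : A^T = A -> A \in unitmx ->
  dot (A *m u + k *: r) (invmx A *m (A *m u + k *: r)) =
  dot u (A *m u) + 2 * k * dot u r + k ^+ 2 * dot r (invmx A *m r).
Proof.
move=> sA uA; have sV : (invmx A)^T = invmx A by rewrite trmx_inv sA.
rewrite mulmxDr mulKmx// -scalemxAr !(dotDl, dotDr, dotZl, dotZr).
by rewrite !(dot_mul_sym _ _ sA) mulKVmx// (dotC r u); ring.
Qed.

End Dot.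

Lemma sup_expR (T : Type) (D : set T) (f : T -> R) x : D x ->
  (forall y, D y -> f y <= f x) -> sup [set expR (f y) | y in D] = expR (f x).
Proof.
move=> Dx le; apply/eqP; rewrite eq_le; apply/andP; split.
  apply: sup_le_ub; first by exists (expR (f x)), x.
  by move=> _ [y Dy <-]; rewrite ler_expR le.
apply: ub_le_sup; last by exists x.
by exists (expR (f x)) => _ [y Dy <-]; rewrite ler_expR le.
Qed.

(** The openness of Theta, in the form used to compare along segments. *)
Lemma Theta_segment p (th v : 'cV[R]_(p + 1)) : Theta th ->
  exists2 e, 0 < e & forall t, 0 <= t <= e -> Theta (th + t *: v).
Proof.
rewrite /Theta /alpha_of /=; set al := th _ _ => al0.
set b := v (rshift p ord0) ord0.
have b0 : 0 < `|b| + 1 by rewrite ltr_wpDl.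
exists (al / (2 * (`|b| + 1))); first by rewrite divr_gt0// mulr_gt0.
move=> t /andP[t0 te]; rewrite !mxE -/al -/b.
have : t * (`|b| + 1) <= al / 2.
  rewrite -ler_pdivlMr//; apply: le_trans te _.
  by rewrite invfM mulrA.
have : - (t * `|b|) <= t * b.
  by rewrite -mulrN ler_wpM2l// lerNl ler_normr lexx orbT.
by have := normr_ge0 b; nra.
Qed.

Lemma quad_mle p (A : 'M[R]_(p + 1)) (c th : 'cV[R]_(p + 1)) :
  A^T = A -> A \in unitmx -> Theta th ->
  (forall u, Theta u -> quad A c u <= quad A c th) ->
  quad A c th = dot c (invmx A *m c).
Proof.
move=> sA uA Tth le; apply: quad_critical => //; apply: quad_local_max => // v.
have [e e0 Te] := Theta_segment v Tth.
by exists e => // t /Te; exact: le.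
Qed.

(** At a maximizer of the sum of two quadratic functions of separate variables,
    each summand is maximal, so that quad_mle gives all three suprema. *)
Lemma Lambda_quadratic d (Omega : measurableType d) p (sigma : R)
    (lnL : 'cV[R]_(p + 1) -> 'cV[R]_(p + 1) -> Omega -> R) (w : Omega)
    (Q Q1 : 'M[R]_(p + 1)) (th0 r r1 : 'cV[R]_(p + 1)) :
  0 < sigma -> Q^T = Q -> Q1^T = Q1 ->
  Q \in unitmx -> Q1 \in unitmx -> Q - Q1 \in unitmx ->
  (forall th th', Theta th -> Theta th' -> lnL th th' w =
    (sigma ^+ 2)^-1 *
      (dot th (Q1 *m th0 + sigma *: r1) +
       dot th' ((Q - Q1) *m th0 + sigma *: (r - r1)))
    - (2 * sigma ^+ 2)^-1 *
      (dot th (Q1 *m th) + dot th' ((Q - Q1) *m th'))) ->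
  mle_exist lnL w ->
  Lambda lnL w =
    (- (r^T *m invmx Q *m r) + r1^T *m invmx Q1 *m r1
     + (r - r1)^T *m invmx (Q - Q1) *m (r - r1)) ord0 ord0.
Proof.
move=> s0 sQ sQ1 uQ uQ1 uQ2 lnLE.
move=> [[th Tth thmax] [th1 [th2 [Tth1 Tth2 th12max]]]].
have sQ2 : (Q - Q1)^T = Q - Q1 by rewrite raddfB/= sQ sQ1.
have s20 : 0 < (2 * sigma ^+ 2)^-1 by rewrite invr_gt0 mulr_gt0// exprn_gt0.
pose c := Q *m th0 + sigma *: r.
pose c1 := Q1 *m th0 + sigma *: r1.
pose c2 := (Q - Q1) *m th0 + sigma *: (r - r1).
have cE : c = c1 + c2.
  by rewrite /c /c1 /c2 addrACA -mulmxDl -scalerDr !(addrC _ (_ - _)) !subrK.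
have lnL2 u v : Theta u -> Theta v ->
    lnL u v w = (2 * sigma ^+ 2)^-1 * (quad Q1 c1 u + quad (Q - Q1) c2 v).
  move=> Tu Tv; rewrite lnLE// /quad (dotC c1) (dotC c2) -/c1 -/c2.
  by field; rewrite gt_eqF.
have lnL1 u : Theta u -> lnL u u w = (2 * sigma ^+ 2)^-1 * quad Q c u.
  move=> Tu; rewrite lnL2//; congr (_ * _); rewrite /quad cE (dotDl c1 c2).
  by rewrite (mulmxBl Q Q1 u) (dotDr u (Q *m u)) dotNr; ring.
have M0 : quad Q c th = dot c (invmx Q *m c).
  apply: quad_mle => // u Tu.
  by have := thmax u Tu; rewrite !lnL1// ler_pM2l.
have M1 : quad Q1 c1 th1 = dot c1 (invmx Q1 *m c1).
  apply: quad_mle => // u Tu.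
  by have := th12max u th2 Tu Tth2; rewrite !lnL2// ler_pM2l// lerD2r.
have M2 : quad (Q - Q1) c2 th2 = dot c2 (invmx (Q - Q1) *m c2).
  apply: quad_mle => // u Tu.
  by have := th12max th1 u Tth1 Tu; rewrite !lnL2// ler_pM2l// lerD2l.
rewrite /Lambda /glr (sup_expR (f := fun u => lnL u u w) Tth thmax).
rewrite (sup_expR (D := @Theta R p `*` @Theta R p)
  (f := fun x : 'cV[R]_(p + 1) * 'cV[R]_(p + 1) => lnL x.1 x.2 w)
  (x := (th1, th2))); last 2 first.
- by split.
- by move=> [u v] [/= Tu Tv]; exact: th12max.
rewrite /= -expRN -expRD expRK lnL1// lnL2// M0 M1 M2 !dot_shift//.
have trip (A : 'M[R]_(p + 1)) u : (u^T *m A *m u) ord0 ord0 = dot u (A *m u).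
  by rewrite /dot mulmxA.
have entry (A C D : 'M[R]_1) :
  (- A + C + D) ord0 ord0 = - A ord0 ord0 + C ord0 ord0 + D ord0 ord0.
  by rewrite !mxE.
rewrite entry !trip (mulmxBl Q Q1 th0) (dotDr th0 (Q *m th0)).
rewrite (dotDr th0 r) !(dotNr th0).
by field; rewrite gt_eqF.
Qed.

End QuadraticLogLikelihood.

(** * From rational parameters to all parameters *)
Section CountableReduction.

Lemma ae_forall_countable d (T : measurableType d) (R : realType)
    (mu : {measure set T -> \bar R}) (I : countType) (Q : I -> T -> Prop) :
  (forall i, {ae mu, forall w, Q i w}) -> {ae mu, forall w, forall i, Q i w}.
Proof.
move=> aeQ; pose Q' n w := if unpickle n is Some i then Q i w else True.
have : {ae mu, forall w (n : nat), Q' n w}.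
  apply/ae_foralln => n; rewrite /Q'.
  case: (unpickle n) => [i|]; first exact: aeQ.
  exact/aeW.
by apply: filterS => w Qw i; have := Qw (pickle i); rewrite /Q' pickleK.
Qed.

Context (R : realType).

(** Approximation strictly from above preserves the positivity of alpha. *)
Definition rat_above (n : nat) (x : R) : rat :=
  (Num.floor (x * n.+1%:R) + 1)%:~R / n.+1%:R.

Lemma rat_above_bounds n x :
  x < ratr (rat_above n x) <= x + n.+1%:R^-1.
Proof.
have n0 : 0 < n.+1%:R :> R by rewrite ltr0n.
rewrite /rat_above fmorph_div/= ratr_int ratr_nat.
have /andP[le lt] := floor_itv (x * n.+1%:R).
rewrite ltr_pdivlMr// lt ler_pdivrMr// mulrDl mulVf ?gt_eqF//.
by rewrite intrD lerD2r.
Qed.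

Lemma cvg_rat_above x : ratr (rat_above n x) @[n --> \oo] --> x.
Proof.
apply/cvgrPdist_lt => e e0; near=> n.
have /andP[lt le] := rat_above_bounds n x.
rewrite distrC ger0_norm ?subr_ge0 1?ltW// ltrBlDl; apply: le_lt_trans le _.
rewrite ltrD2l; near: n; exact: near_infty_natSinv_lt (PosNum e0).
Unshelve. all: by end_near. Qed.

Definition rat_mx_above n m (u : 'cV[R]_m) : 'cV[rat]_m :=
  map_mx (rat_above n) u.

Lemma cvg_rat_mx_above m (u : 'cV[R]_m.+1) :
  map_mx ratr (rat_mx_above n u) @[n --> \oo] --> u.
Proof.
apply/cvgrPdist_lt => e e0; near=> n.
rewrite [`|_|]mx_normrE; apply: bigmax_lt => // -[i j] _ /=; rewrite !mxE.
have /andP[lt le] := rat_above_bounds n (u i j).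
rewrite distrC ger0_norm ?subr_ge0 1?ltW// ltrBlDl; apply: le_lt_trans le _.
rewrite ltrD2l; near: n; exact: near_infty_natSinv_lt (PosNum e0).
Unshelve. all: by end_near. Qed.

Lemma Theta_rat_above n p (u : 'cV[R]_(p + 1)) :
  Theta u -> Theta (map_mx ratr (rat_mx_above n u) : 'cV[R]_(p + 1)).
Proof.
rewrite /Theta /alpha_of /= !mxE => u0.
by have /andP[lt _] := rat_above_bounds n (u (rshift p ord0) ord0);
  exact: lt_trans lt.
Qed.

Lemma cvg_dot m (a_ b_ : nat -> 'cV[R]_m) (a b : 'cV[R]_m) :
  (forall i, a_ n i ord0 @[n --> \oo] --> a i ord0) ->
  (forall i, b_ n i ord0 @[n --> \oo] --> b i ord0) ->
  dot (a_ n) (b_ n) @[n --> \oo] --> dot a b.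
Proof.
move=> ca cb; rewrite dotE; under eq_cvg do rewrite dotE.
apply: cvg_big => [|i _]; first exact: add_continuous.
exact: cvgM (ca i) (cb i).
Qed.

Lemma cvg_mulmx_col m (A : 'M[R]_m) (a_ : nat -> 'cV[R]_m) (a : 'cV[R]_m) :
  (forall i, a_ n i ord0 @[n --> \oo] --> a i ord0) ->
  forall i, (A *m a_ n) i ord0 @[n --> \oo] --> (A *m a) i ord0.
Proof.
move=> ca i; rewrite mxE; under eq_cvg do rewrite mxE.
apply: cvg_big => [|j _]; first exact: add_continuous.
exact: cvgM (cvg_cst _) (ca j).
Qed.

(** Both sides are continuous along the rational approximations, which stay in
    Theta. *)
Lemma dense_Theta_eq p (k1 k2 : R) (A1 A2 : 'M[R]_(p + 1))
    (c1 c2 : 'cV[R]_(p + 1)) (f : 'cV[R]_(p + 1) -> 'cV[R]_(p + 1) -> R) :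
  let g u v := k1 * (dot u c1 + dot v c2)
    - k2 * (dot u (A1 *m u) + dot v (A2 *m v)) in
  {within @Theta R p `*` @Theta R p, continuous (fun th => f th.1 th.2)} ->
  (forall q : 'cV[rat]_(p + 1) * 'cV[rat]_(p + 1),
     Theta (map_mx ratr q.1 : 'cV[R]_(p + 1)) ->
     Theta (map_mx ratr q.2 : 'cV[R]_(p + 1)) ->
     f (map_mx ratr q.1) (map_mx ratr q.2) =
     g (map_mx ratr q.1) (map_mx ratr q.2)) ->
  forall u v, Theta u -> Theta v -> f u v = g u v.
Proof.
move=> g /subspace_continuousP cf fg u v Tu Tv.
pose r n (x : 'cV[R]_(p + 1)) : 'cV[R]_(p + 1) :=
  map_mx ratr (rat_mx_above n x).
have cr x : r n x @[n --> \oo] --> x.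
  rewrite /r; case: (p + 1)%N (addn1 p) x => // m _ x.
  exact: cvg_rat_mx_above.
have cri x i : r n x i ord0 @[n --> \oo] --> x i ord0.
  by under eq_cvg do rewrite !mxE; exact: cvg_rat_above.
have cf' : f (r n u) (r n v) @[n --> \oo] --> f u v.
  have cuv : (r n u, r n v) @[n --> \oo] --> (u, v).
    exact: (cvg_pair (cr u) (cr v)).
  move=> U /(cf (u, v) (conj Tu Tv)) /= nU.
  have : \forall n \near \oo, (@Theta R p `*` @Theta R p) (r n u, r n v) ->
      U (f (r n u) (r n v)) by exact: (cuv _ nU).
  by apply: filterS => n; apply; split; exact: Theta_rat_above.
have cg : g (r n u) (r n v) @[n --> \oo] --> g u v.
  have cst_ (x : 'cV[R]_(p + 1)) i : x i ord0 @[_ --> \oo] --> x i ord0.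
    exact: cvg_cst.
  apply: cvgB; apply: cvgM; (try exact: cvg_cst);
    apply: cvgD; apply: cvg_dot => //.
  - exact: cvg_mulmx_col.
  - exact: cvg_mulmx_col.
have E : (fun n => f (r n u) (r n v)) = (fun n => g (r n u) (r n v)).
  apply/funext => n; apply: (fg (rat_mx_above n u, rat_mx_above n v));
    exact: Theta_rat_above.
rewrite E in cf'.
exact: (cvg_unique _ cf' cg).
Qed.

End CountableReduction.

(** * Gram matrices of square integrable functions *)
Section GramMatrix.
Context (R : realType).
Local Notation mu := lebesgue_measure.

Definition square_integrable (D : set R) (f : R -> R) : Prop :=
  measurable_fun D f /\ (\int[mu]_(t in D) (f t ^+ 2)%:E < +oo)%E.

Lemma square_integrableS (D E : set R) f : measurable D -> measurable E ->
  E `<=` D -> square_integrable D f -> square_integrable E f.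
Proof.
move=> mD mE ED [mf lf]; split; first exact: measurable_funS mf.
apply: le_lt_trans lf; apply: ge0_subset_integral => //.
- exact/measurable_EFinP/measurable_funX.
- by move=> t _; rewrite lee_fin sqr_ge0.
Qed.

Lemma square_integrable_comb (D : set R) x y f g : measurable D ->
  square_integrable D f -> square_integrable D g ->
  square_integrable D (fun t => x * f t + y * g t).
Proof.
move=> mD [mf lf] [mg lg]; split.
  by apply: measurable_funD; exact: measurable_funM.
apply: le_lt_trans (ge0_integral_sqr_comb x y mD mf mg) _.
rewrite lte_mul_pinfty ?lee_fin//.
  by rewrite !addr_ge0// pmulr_rge0// sqr_ge0.
by rewrite lte_add_pinfty.
Qed.

Lemma square_integrableM (D : set R) f g : measurable D ->
  square_integrable D f -> square_integrable D g ->
  mu.-integrable D (EFin \o (fun t => f t * g t)).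
Proof.
move=> mD [mf lf] [mg lg].
have mf2 : measurable_fun D (fun t => (f t ^+ 2)%:E).
  exact/measurable_EFinP/measurable_funX.
have mg2 : measurable_fun D (fun t => (g t ^+ 2)%:E).
  exact/measurable_EFinP/measurable_funX.
have ge0 h t : (0 <= (h t ^+ 2)%:E :> \bar R)%E by rewrite lee_fin sqr_ge0.
have if2 : mu.-integrable D (fun t => (f t ^+ 2)%:E).
  apply/integrableP; split=> //.
  by under eq_integral do rewrite gee0_abs//.
have ig2 : mu.-integrable D (fun t => (g t ^+ 2)%:E).
  apply/integrableP; split=> //.
  by under eq_integral do rewrite gee0_abs//.
have ifg := @integrableD _ (measurableTypeR R) R mu D mD _ _ if2 ig2.
apply: (@le_integrable _ (measurableTypeR R) R mu D mD _ _ _ _ ifg).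
  exact/measurable_EFinP/measurable_funM.
move=> t _; change (`|f t * g t|%:E <= `|f t ^+ 2 + g t ^+ 2|%:E)%E.
rewrite lee_fin normrM.
rewrite [leRHS]ger0_norm ?addr_ge0 ?sqr_ge0//.
rewrite -[f t ^+ 2]real_normK ?num_real// -[g t ^+ 2]real_normK ?num_real//.
move: (`|f t|) (`|g t|) (normr_ge0 (f t)) (normr_ge0 (g t)) => u v u0 v0.
by have := sqr_ge0 (u - v); nra.
Qed.

Lemma Rintegral_sum (D : set R) (I : Type) (s : seq I) (f : I -> R -> R) :
  measurable D -> (forall i, mu.-integrable D (EFin \o f i)) ->
  \int[mu]_(t in D) (\sum_(i <- s) f i t) =
  \sum_(i <- s) \int[mu]_(t in D) f i t.
Proof.
move=> mD fi; rewrite /Rintegral.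
under eq_integral do rewrite -sumEFin.
rewrite (@integral_sum _ (measurableTypeR R) R mu D mD I _ fi).
rewrite (eq_bigr (fun i => (fine (\int[mu]_(x in D) (f i x)%:E)%E)%:E)).
  by rewrite sumEFin.
by move=> i _; rewrite fineK//; exact: (integrable_fin_num _ (fi i)).
Qed.

Lemma Rintegral_gram n (D : set R) (psi : 'I_n -> R -> R) (Q : 'M[R]_n)
    (u v : 'cV[R]_n) : measurable D ->
  (forall i, square_integrable D (psi i)) ->
  (forall i j, Q i j = \int[mu]_(t in D) (psi i t * psi j t)) ->
  \int[mu]_(t in D) ((\sum_i u i ord0 * psi i t) * (\sum_j v j ord0 * psi j t))
  = dot u (Q *m v).
Proof.
move=> mD sq QE.
have int i j (k : R) :
    mu.-integrable D (EFin \o (fun t => k * (psi i t * psi j t))).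
  have := square_integrableM mD (sq i) (sq j).
  exact: integrableZl.
under eq_Rintegral => t _.
  rewrite mulr_suml.
  under eq_bigr => i _.
    rewrite mulr_sumr.
    under eq_bigr do rewrite mulrACA.
    over.
  over.
rewrite Rintegral_sum//; last first.
  move=> i; rewrite (_ : EFin \o _ =
    (fun t => \sum_(j < n) (u i ord0 * v j ord0 * (psi i t * psi j t))%:E)%E).
    by apply: integrable_sum => // j _; exact: int.
  by apply/funext => t /=; rewrite sumEFin.
rewrite dotE; apply: eq_bigr => i _.
rewrite Rintegral_sum// mxE mulr_sumr; apply: eq_bigr => j _.
rewrite RintegralZl//; last exact: square_integrableM.
by rewrite QE -!mulrA [v j ord0 * _]mulrC.
Qed.

End GramMatrix.

(** * The regressors of the model *)
Section Features.
Context (R : realType) (d : measure_display) (Omega : measurableType d).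
Context (P : probability Omega R) (p : nat) (phi : 'I_p -> R -> R).
Context (B X : R -> Omega -> R).
Local Notation mu := lebesgue_measure.
Implicit Types (theta : 'cV[R]_(p + 1)) (i j : 'I_(p + 1)).

(** The factor of the coordinate theta_i in S(theta, t, X_t). *)
Definition feature i (t : R) (w : Omega) : R :=
  match fintype.split i with inl k => phi k t | inr _ => - X t w end.

Lemma feature_l k : feature (lshift 1 k) = fun t _ => phi k t.
Proof. by rewrite /feature (unsplitK (inl k)). Qed.

Lemma feature_r k : feature (rshift p k) = fun t w => - X t w.
Proof. by rewrite /feature (unsplitK (inr k)). Qed.

Lemma Sfun_feature theta t w :
  Sfun phi theta t (X t w) = \sum_i theta i ord0 * feature i t w.
Proof.
rewrite big_split_ord big_ord1 /= feature_r mulrN /Sfun; congr (_ - _).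
by apply: eq_bigr => k _; rewrite feature_l.
Qed.

Lemma trmx_Q_mx T w : (Q_mx phi X T w)^T = Q_mx phi X T w.
Proof.
rewrite /Q_mx tr_block_mx raddfN/= trmxK raddfN/= tr_scalar_mx; congr block_mx.
apply/matrixP => i j; rewrite !mxE.
by apply: eq_Rintegral => t _; rewrite mulrC.
Qed.

Lemma Q_mx_feature T w i j :
  (forall k, square_integrable `[0, T] (fun t => feature k t w)) ->
  Q_mx phi X T w i j = \int[mu]_(t in `[0, T]) (feature i t w * feature j t w).
Proof.
move=> sq.
have sqX : square_integrable `[0, T] (fun t => X t w).
  have := sq (rshift p ord0); rewrite feature_r => sN.
  have := square_integrable_comb (-1) 0 (measurable_itv _) sN sN.
  congr square_integrable; apply/funext => t.
  by rewrite mulN1r opprK mul0r addr0.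
have offdiag (k : 'I_p) : - (\int[mu]_(t in `[0, T]) (phi k t * X t w)) =
    \int[mu]_(t in `[0, T]) (phi k t * - X t w).
  have sk := sq (lshift 1 k); rewrite feature_l in sk.
  rewrite -mulN1r -RintegralZl//; last exact: square_integrableM.
  by apply: eq_Rintegral => t _; rewrite mulrCA mulN1r.
rewrite /Q_mx; case: (split_ordP i) => k ->; case: (split_ordP j) => l ->.
- by rewrite block_mxEul mxE !feature_l.
- by rewrite block_mxEur !mxE feature_l feature_r offdiag.
- rewrite block_mxEdl !mxE feature_l feature_r offdiag.
  by apply: eq_Rintegral => t _; rewrite mulrC.
- rewrite block_mxEdr !mxE !ord1 eqxx mulr1n feature_r.
  by apply: eq_Rintegral => t _; rewrite mulrNN expr2.
Qed.

(** The regressor i is the difference of S at theta + e_i and at theta. *)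
Lemma feature_square_integrable (D : set R) theta w : measurable D ->
  (forall i, measurable_fun D (fun t => feature i t w)) ->
  (\int[mu]_(t in D) (Sfun phi theta t (X t w) ^+ 2)%:E < +oo)%E ->
  (forall i, \int[mu]_(t in D)
    (Sfun phi (theta + delta_mx i ord0) t (X t w) ^+ 2)%:E < +oo)%E ->
  forall i, square_integrable D (fun t => feature i t w).
Proof.
move=> mD mf S0 S1 i.
have mS th : measurable_fun D (fun t => Sfun phi th t (X t w)).
  under eq_fun do rewrite Sfun_feature.
  by apply: measurable_sum => k; exact: measurable_funM.
have := square_integrable_comb 1 (-1) mD (conj (mS _) (S1 i)) (conj (mS _) S0).
congr square_integrable; apply/funext => t.
rewrite mul1r mulN1r !Sfun_feature -sumrB (bigD1 i)//= big1 ?addr0.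
  by rewrite !mxE !eqxx mulrDl addrAC subrr add0r mul1r.
by move=> k ki; rewrite !mxE (negbTE ki)/= addr0 subrr.
Qed.

Lemma Theta_delta theta i : Theta theta -> Theta (theta + delta_mx i ord0).
Proof.
rewrite /Theta /alpha_of /= !mxE => th0.
by rewrite ltr_wpDr//; case: (_ && _).
Qed.

Lemma ae_measurable_pathsS a b a' b' (H : R -> Omega -> R) :
  a <= a' -> b' <= b ->
  ae_measurable_paths P a b H -> ae_measurable_paths P a' b' H.
Proof.
move=> aa bb; apply: filterS => w; apply: measurable_funS => // t /=.
by rewrite !in_itv/= => /andP[at_ tb]; rewrite (le_trans aa)// (le_trans tb).
Qed.

Lemma ae_measurable_feature a b i : (forall k, measurable_fun setT (phi k)) ->
  ae_measurable_paths P a b X -> ae_measurable_paths P a b (feature i).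
Proof.
move=> mphi; case: (split_ordP i) => k ->.
  by rewrite feature_l => _; apply: aeW => w; exact: measurable_funTS.
rewrite feature_r; apply: filterS => w mX.
by apply: measurableT_comp => //; exact: oppr_measurable.
Qed.

Hypothesis mphi : forall k, measurable_fun setT (phi k).
Local Notation ito := (is_ito_integral P (filtration (X 0) B) B).

(** The last entry of R is minus an Ito integral of X, hence an Ito integral of
    - X by linearity. *)
Lemma is_R_vector_feature T RT i : ae_measurable_paths P 0 T X ->
  is_R_vector P phi B X T RT -> ito 0 T (feature i) (fun w => RT w i ord0).
Proof.
move=> mX [Rphi [I IX RX]]; case: (split_ordP i) => k ->.
  by rewrite feature_l; exact: Rphi.
have := ito_integral_comb (-1) 0 mX mX IX IX; rewrite feature_r !ord1.
congr is_ito_integral.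
  by apply/funext => t; apply/funext => w; rewrite mulN1r mul0r addr0.
by apply/funext => w; rewrite mulN1r mul0r addr0 RX.
Qed.

Lemma ito_integral_Sfun T RT theta : 0 <= T -> ae_measurable_paths P 0 T X ->
  is_R_vector P phi B X T RT ->
  ito 0 T (fun t w => Sfun phi theta t (X t w)) (fun w => dot theta (RT w)).
Proof.
move=> T0 mX RTP.
have := ito_integral_sum (fun i => theta i ord0) T0
  (fun i => ae_measurable_feature i mphi mX)
  (fun i => is_R_vector_feature i mX RTP).
congr is_ito_integral.
  by apply/funext => t; apply/funext => w; rewrite Sfun_feature.
by apply/funext => w; rewrite dotE.
Qed.

Lemma ae_measurable_Sfun a b theta : ae_measurable_paths P a b X ->
  ae_measurable_paths P a b (fun t w => Sfun phi theta t (X t w)).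
Proof.
move=> mX; have := ae_measurable_paths_sum (fun i => theta i ord0)
  (fun i => ae_measurable_feature i mphi mX).
congr ae_measurable_paths.
by apply/funext => t; apply/funext => w; rewrite Sfun_feature.
Qed.

Lemma Rintegral_Sfun_Q T w th th' :
  (forall k, square_integrable `[0, T] (fun t => feature k t w)) ->
  \int[mu]_(t in `[0, T]) (Sfun phi th t (X t w) * Sfun phi th' t (X t w)) =
  dot th (Q_mx phi X T w *m th').
Proof.
move=> sq; under eq_Rintegral do rewrite !Sfun_feature.
by apply: Rintegral_gram => // i j; exact: Q_mx_feature.
Qed.

Lemma Rintegral_Sfun_QB T tau w th th' : 0 <= tau -> tau <= T ->
  (forall k, square_integrable `[0, T] (fun t => feature k t w)) ->
  \int[mu]_(t in `[tau, T]) (Sfun phi th t (X t w) * Sfun phi th' t (X t w)) =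
  dot th ((Q_mx phi X T w - Q_mx phi X tau w) *m th').
Proof.
move=> tau0 tauT sq; under eq_Rintegral do rewrite !Sfun_feature.
have sq0 k : square_integrable `[0, tau] (fun t => feature k t w).
  apply: square_integrableS (sq k) => // t /=.
  by rewrite !in_itv/= => /andP[-> /le_trans->].
have sq1 k : square_integrable `[tau, T] (fun t => feature k t w).
  apply: square_integrableS (sq k) => // t /=.
  by rewrite !in_itv/= => /andP[/(le_trans tau0)-> ->].
have sq2 k : square_integrable `]tau, T] (fun t => feature k t w).
  apply: square_integrableS (sq1 k) => // t /=.
  by rewrite !in_itv/= => /andP[/ltW-> ->].
apply: Rintegral_gram => // i j.
have entryB (A C : 'M[R]_(p + 1)) : (A - C) i j = A i j - C i j by rewrite !mxE.
rewrite entryB !Q_mx_feature//.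
rewrite Rintegral_itvB ?bnd_simp//; last exact: square_integrableM.
by rewrite Rintegral_itv_obnd_cbnd//; exact: square_integrableM.
Qed.

End Features.

(** * The generalized likelihood ratio *)
Theorem proposition2p2
  (R : realType) (d : measure_display) (Omega : measurableType d)
  (P : probability Omega R)
  (p : nat) (phi : 'I_p -> R -> R) (sigma : R) (B X : R -> Omega -> R)
  (theta0 : 'cV[R]_(p + 1)) (T s : R)
  (R_T R_tau : Omega -> 'cV[R]_(p + 1))
  (lnL : 'cV[R]_(p + 1) -> 'cV[R]_(p + 1) -> Omega -> R) :
  let tau := s * T in
  let Q_T := Q_mx phi X T in
  let Q_tau := Q_mx phi X tau in
  0 < T -> 0 < s < 1 -> 0 < sigma ->
  (forall i, measurable_fun setT (phi i)) ->
  standard_brownian_motion P B ->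
  measurable_fun setT (X 0) ->
  P.-integrable setT (fun w => (X 0 w ^+ 2)%:E) ->
  independent_sigma P (preimage_set_system setT (X 0) measurable)
    (sigma_of `[0, +oo[ B) ->
  Theta theta0 ->
  is_solution P phi sigma B X theta0 T ->
  (forall T' : R, 0 <= T' -> forall theta, Theta theta ->
     {ae P, forall w,
       (\int[lebesgue_measure]_(t in `[0%R, T'])
          (Sfun phi theta t (X t w) ^+ 2)%:E < +oo)%E}) ->
  {ae P, forall w, [/\ Q_T w \in unitmx, Q_tau w \in unitmx &
                       (Q_T w - Q_tau w) \in unitmx]} ->
  is_R_vector P phi B X T R_T ->
  is_R_vector P phi B X tau R_tau ->
  is_log_likelihood P phi sigma B X theta0 tau T lnL ->
  {ae P, forall w, mle_exist lnL w ->
    Lambda lnL w =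
      (- ((R_T w)^T *m invmx (Q_T w) *m R_T w)
       + (R_tau w)^T *m invmx (Q_tau w) *m R_tau w
       + (R_T w - R_tau w)^T *m invmx (Q_T w - Q_tau w)
           *m (R_T w - R_tau w)) ord0 ord0}.
Proof.
move=> tau Q_T Q_tau T0 /andP[s0 s1] sg0 mphi BM mX0 _ ind0 Tth0 [_ cX _] Sfin
  uQ RTP RtauP [lnLP lnLc].
have T0' := ltW T0.
have tau0 : 0 <= tau by rewrite mulr_ge0// ltW.
have tauT : tau <= T by rewrite ler_piMl// ltW.
have mX : ae_measurable_paths P 0 T X.
  by apply: filterS cX => w; exact: subspace_continuous_measurable_fun.
have mXtau : ae_measurable_paths P 0 tau X by apply: ae_measurable_pathsS mX.
have sq : {ae P, forall w k,
    square_integrable `[0, T] (fun t => feature phi X k t w)}.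
  have mf : {ae P, forall w k,
      measurable_fun `[0, T] (fun t => feature phi X k t w)}.
    by apply: ae_forall_countable => k; exact: ae_measurable_feature.
  have S1 : {ae P, forall w (k : 'I_(p + 1)),
      (\int[lebesgue_measure]_(t in `[0%R, T])
      (Sfun phi (theta0 + delta_mx k ord0) t (X t w) ^+ 2)%:E < +oo)%E}.
    by apply: ae_forall_countable => k; apply: Sfin => //; exact: Theta_delta.
  apply: filterS3 mf (Sfin T T0' _ Tth0) S1 => w mfw S0w S1w.
  exact: (@feature_square_integrable _ _ _ _ _ _ _ theta0).
pose loglik th th' w := (sigma ^+ 2)^-1 *
      (dot th (Q_tau w *m theta0 + sigma *: R_tau w) +
       dot th' ((Q_T w - Q_tau w) *m theta0 + sigma *: (R_T w - R_tau w)))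
    - (2 * sigma ^+ 2)^-1 *
      (dot th (Q_tau w *m th) + dot th' ((Q_T w - Q_tau w) *m th')).
have lnL_ae th th' : Theta th -> Theta th' ->
    {ae P, forall w, lnL th th' w = loglik th th' w}.
  move=> Tth Tth'.
  have [J1 [J2 [[I1 I1P J1E] [I2 I2P J2E] lnLE]]] := lnLP th th' Tth Tth'.
  have I1E : {ae P, forall w, I1 w = dot th (R_tau w)}.
    apply: (ito_integral_unique BM mX0 ind0 (lexx 0) _ I1P).
      exact: ae_measurable_Sfun.
    exact: ito_integral_Sfun.
  (* I2 is completed to an integral over [0, T], where uniqueness applies. *)
  have I2E : {ae P, forall w, dot th' (R_tau w) + I2 w = dot th' (R_T w)}.
    have mS := ae_measurable_Sfun mphi th' mX.
    apply: (ito_integral_unique BM mX0 ind0 (lexx 0) mS); last first.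
      exact: ito_integral_Sfun.
    apply: (ito_integral_cat tau0 tauT mS) I2P.
    exact: ito_integral_Sfun.
  apply: filterS2 (filterI sq (filterI I1E I2E))
    (filterI lnLE (filterI J1E J2E)).
  move=> w [sqw [I1w I2w]] [-> [-> ->]].
  have sqtau k : square_integrable `[0, tau] (fun t => feature phi X k t w).
    apply: square_integrableS (sqw k) => // t /=.
    by rewrite !in_itv/= => /andP[-> /le_trans->].
  have sqr D u : \int[lebesgue_measure]_(t in D) (Sfun phi u t (X t w) ^+ 2) =
      \int[lebesgue_measure]_(t in D)
        (Sfun phi u t (X t w) * Sfun phi u t (X t w)).
    by apply: eq_Rintegral => t _; rewrite expr2.
  rewrite !sqr !Rintegral_Sfun_Q// !Rintegral_Sfun_QB// /loglik.
  rewrite I1w !(dotDr th, dotDr th', dotZr, dotNr) -/Q_T -/Q_tau -I2w.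
  by field; rewrite gt_eqF.
have lnL_rat : {ae P, forall w (q : 'cV[rat]_(p + 1) * 'cV[rat]_(p + 1)),
    Theta (map_mx ratr q.1 : 'cV[R]_(p + 1)) ->
    Theta (map_mx ratr q.2 : 'cV[R]_(p + 1)) ->
    lnL (map_mx ratr q.1) (map_mx ratr q.2) w =
    loglik (map_mx ratr q.1) (map_mx ratr q.2) w}.
  apply: ae_forall_countable => q.
  have [T1|nT1] := pselect (Theta (map_mx ratr q.1 : 'cV[R]_(p + 1)));
    last by apply: aeW => w /nT1.
  have [T2|nT2] := pselect (Theta (map_mx ratr q.2 : 'cV[R]_(p + 1)));
    last by apply: aeW => w _ /nT2.
  by apply: filterS (lnL_ae _ _ T1 T2).
apply: filterS3 uQ lnL_rat lnLc => w [uT utau uB] lnLw cw.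
apply: (@Lambda_quadratic _ _ _ _ sigma lnL w (Q_T w) (Q_tau w) theta0) => //.
- exact: trmx_Q_mx.
- exact: trmx_Q_mx.
- exact: (dense_Theta_eq cw lnLw).
Qed.
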